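(* Let $a,b,c,d>0$. Then for all $0\le k\le n$, writing $\mathsf W=W^{(a-1,b-1,c-1,d-1)}$ and $\mathsf H_{m,j}=H_{m,j}^{(a-1,b-1,c-1,d-1)}$, $$\frac{\partial}{\partial x}\left[W^{(a,b,c,d)}H_{n,k}^{(a,b,c,d)}\right]=\sum_{m=n+1}^{n+\deg\rho^2+1}\bar c_{m,k}^{\,x,(n,k)}\,\mathsf W\,\mathsf H_{m,k}+\sum_{m=n-\deg\rho^2+3}^{n+3}\bar c_{m,k+2}^{\,x,(n,k)}\,\mathsf W\,\mathsf H_{m,k+2}+\sum_{m=n-d_0+2}^{n+d_0+2}\bar c_{m,k+1}^{\,x,(n,k)}\,\mathsf W\,\mathsf H_{m,k+1},$$ where $$\bar c_{m,k}^{\,x,(n,k)}=\Big(-r_k^{(d,c)}\,\mathcal T_{(a,b,c+d+2k+\eta)}^{(a,b,c+d+2k+1)}\,D_\eta(w_R^{(a-1,b-1,c+d+2k-1)})\Big)_{[n-k,m-k]},$$ $$\bar c_{m,k+2}^{\,x,(n,k)}=\Big(s_k^{(d,c)}\,\rho^2\big(J(w_R^{(a,b,c+d+2k+1)})\big)\,D_\eta(w_R^{(a-1,b-1,c+d+2k-\eta)})\,\big(\mathcal T_{(a-1,b-1,c+d+2k-\eta)}^{(a-1,b-1,c+d+2k+3)}\big)^{-1}$$ $$\quad+\big[(k+2)s_k^{(d,c)}+\delta_k^{(d,c)}d_{k+1}^{(d,c)}\big](\rho\rho')\big(J(w_R^{(a,b,c+d+2k+1)})\big)\,\mathcal T_{(a-1,b-1,c+d+2k+1)}^{(a,b,c+d+2k+1)}\big(\mathcal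 T_{(a-1,b-1,c+d+2k+1)}^{(a-1,b-1,c+d+2k+3)}\big)^{-1}\Big)_{[n-k,m-k-2]},$$ and in case (i) $$\bar c_{m,k+1}^{\,x,(n,k)}=\Big(t_k^{(d,c)}\,\rho\big(J(w_R^{(a,b,c+d+2k+1)})\big)\,D_0(w_R^{(a-1,b-1,c+d+2k)})\,\big(\mathcal T_{(a-1,b-1,c+d+2k)}^{(a-1,b-1,c+d+2k+1)}\big)^{-1}$$ $$\quad+\big[(k+1)t_k^{(d,c)}+\gamma_k^{(d,c)}d_k^{(d,c)}\big]\,\rho'\big(J(w_R^{(a,b,c+d+2k+1)})\big)\,\mathcal T_{(a-1,b-1,c+d+2k+1)}^{(a,b,c+d+2k+1)}\Big)_{[n-k,m-k-1]},$$ while in case (ii) $\bar c_{m,k+1}^{\,x,(n,k)}=0$ (the third sum is absent). Hence the matrix $W_x^{(a,b,c,d)}$, defined by $\frac{\partial}{\partial x}\mathbf W^{(a,b,c,d)}=\mathbf W^{(a-1,b-1,c-1,d-1)}W_x^{(a,b,c,d)}$, has block-bandwidths $(\deg\rho^2+1,\deg\rho^2-3)$ and each block has bandwidths $(2,0)$.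
   Context: Setting. Let $\alpha<\beta$ and $\gamma<\delta$ be real, and let $\rho$ be a function on $[\alpha,\beta]$, positive on $(\alpha,\beta)$, with either: case (i), $\rho$ is a polynomial of degree $d_0$ (so $\deg\rho^2=2d_0$); or case (ii), $\rho$ is the square root of a polynomial of degree $d_1=\deg\rho^2$ and $\delta=-\gamma>0$. Put $\eta=0$ in case (i), $\eta=1$ in case (ii), so $d_\eta=\deg\rho^{1+\eta}$; assume $d_\eta\ge 2+\eta$. Let $\Omega=\{(x,y):\alpha\le x\le\beta,\ \gamma\rho(x)\le y\le\delta\rho(x)\}$. All parameters are real, families of orthogonal polynomials have parameters $>-1$ and integrable weights, and $c=d$ in case (ii). Polynomials. $w_R^{(a,b,s)}(x)=(\beta-x)^a(x-\alpha)^b\rho(x)^s$ on $[\alpha,\beta]$, and $R_n^{(a,b,s)}$ ($n\ge0$) are the orthonormal polynomials (degree $n$, positive leading coefficient) for this weight; $\mathbf R^{(a,b,s)}=(R_0^{(a,b,s)},R_1^{(a,b,s)},\dots)$. $w_P^{(d,c)}(y)=(\delta-y)^d(y-\gamma)^c$ on $[\gamma,\delta]$, with orthonormal polynomials $\widetilde P_n^{(d,c)}$ (shifted normalised Jacobi polynomials, positive leading coefficient). Constants $r,t,s,\delta_n,\gamma_n,d_n$ (with superscripts; not to be confused with the endpoints or parameters) are defined by $$\widetilde P_n^{(d,c)}=r_n^{(d+1,c+1)}\widetilde P_n^{(d+1,c+1)}-t_{n-1}^{(d+1,c+1)}\widetilde P_{n-1}^{(d+1,c+1)}-s_{n-2}^{(d+1,c+1)}\widetilde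 P_{n-2}^{(d+1,c+1)},$$ $$y\widetilde P_n^{(d,c)}=\delta_n^{(d,c)}\widetilde P_{n+1}^{(d,c)}+\gamma_n^{(d,c)}\widetilde P_n^{(d,c)}+\delta_{n-1}^{(d,c)}\widetilde P_{n-1}^{(d,c)},\qquad \tfrac{\mathrm d}{\mathrm dy}\widetilde P_n^{(d,c)}=d_{n-1}^{(d+1,c+1)}\widetilde P_{n-1}^{(d+1,c+1)}.$$ The generalised Koornwinder polynomials are $$H_{n,k}^{(a,b,c,d)}(x,y)=R_{n-k}^{(a,b,c+d+2k+1)}(x)\,\rho(x)^k\,\widetilde P_k^{(d,c)}(y/\rho(x)),\quad 0\le k\le n,$$ orthonormal on $\Omega$ with respect to $W^{(a,b,c,d)}(x,y)=(\beta-x)^a(x-\alpha)^b(y-\gamma\rho(x))^c(\delta\rho(x)-y)^d$. $\mathbf H^{(a,b,c,d)}$ is the infinite row vector of all $H_{n,k}^{(a,b,c,d)}$, ordered in blocks $n=0,1,2,\dots$, block $n$ being $(H_{n,0},\dots,H_{n,n})$, and $\mathbf W^{(a,b,c,d)}=W^{(a,b,c,d)}\mathbf H^{(a,b,c,d)}$. Matrices. $J(w_R^{(a,b,s)})$ is the tridiagonal Jacobi matrix defined by $x\,\mathbf R^{(a,b,s)}=\mathbf R^{(a,b,s)}J(w_R^{(a,b,s)})$; for a polynomial $f$, $f(J)$ is the usual matrix polynomial (note $\rho^2$ and $\rho\rho'$ are polynomials in both cases). $\mathcal T_{(a,b,s)}^{(a',b',s')}$ is the upper triangular raising matrix defined by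 $\mathbf R^{(a,b,s)}=\mathbf R^{(a',b',s')}\mathcal T_{(a,b,s)}^{(a',b',s')}$. $D_\eta(w_R^{(a,b,s)})$ is the differentiation matrix defined by $\frac{\mathrm d}{\mathrm dx}\mathbf R^{(a,b,s)}=\mathbf R^{(a+1,b+1,s+1+\eta)}D_\eta(w_R^{(a,b,s)})$. Conventions. $A_{[i,j]}$ is the entry in row $i+1$, column $j+1$ of $A$, and is $0$ if $i<0$ or $j<0$. Terms $H_{m,j}$ with indices outside $0\le j\le m$ are omitted (zero). A matrix has bandwidths $(\sigma,\mu)$ if $A_{[i,j]}=0$ whenever $i-j>\sigma$ or $j-i>\mu$ ($\sigma$ or $\mu$ may be negative); block-bandwidths are defined in the same way, with block $(i,j)$ (of size $(i+1)\times(j+1)$) in place of entry $[i,j]$, and ''each block has bandwidths'' refers to bandwidths within the blocks. *)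

(* Defs.v *)
From mathcomp Require Export all_boot all_order all_algebra.
From mathcomp Require Export all_classical all_reals all_analysis.
Export Order.TTheory GRing.Theory Num.Theory.
Export numFieldNormedType.Exports.

Set Implicit Arguments.
Unset Strict Implicit.
Unset Printing Implicit Defensive.

Local Open Scope classical_set_scope.
Local Open Scope ring_scope.

(* Matrices indexed by nat * nat.  The sum in [imul] is a sum of finite support
   (it is 0 if the support is infinite).  The matrices used below have finitely
   many nonzero entries in each column, so that all their products are genuine. *)
Definition imatrix (R : realType) := nat -> nat -> R.

Definition imul (R : realType) (A B : imatrix R) : imatrix R :=
  fun i j => \sum_(l \in [set: nat]) A i l * B l j.

Definition iid (R : realType) : imatrix R := fun i j => (i == j)%:R.

Definition ipow (R : realType) (A : imatrix R) (n : nat) : imatrix R :=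
  iter n (imul A) (iid R).

Definition ipoly (R : realType) (f : {poly R}) (A : imatrix R) : imatrix R :=
  fun i j => \sum_(l < size f) f`_l * ipow A l i j.

(* Two-sided inverse among upper triangular matrices, where it is unique;
   a general infinite matrix may have several inverses. *)
Definition iinv (R : realType) (A : imatrix R) : imatrix R :=
  xget (fun _ _ => 0)
    [set B | [/\ forall i j, (j < i)%N -> B i j = 0,
                 imul A B = iid R & imul B A = iid R]].

(* Sequence of coordinates of f on q_0, q_1, ..., i.e. the finitely supported
   column c such that f = (q_0, q_1, ...) c.  It exists and is unique if each
   q_n has degree n. *)
Definition coord (R : realType) (q : nat -> {poly R}) (f : {poly R}) : nat -> R :=
  xget (fun _ => 0)
    [set c | exists N, (forall i, (N <= i)%N -> c i = 0) /\
                       f = \sum_(i < N) c i *: q i].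

Definition orthonormal_polys (R : realType) (u v : R) (w : R -> R)
    (p : nat -> {poly R}) : Prop :=
  [/\ forall n, size (p n) = n.+1,
      forall n, 0 < lead_coef (p n) &
      forall m n, (\int[lebesgue_measure]_(x in `[u, v])
        ((p m).[x] * (p n).[x] * w x)%:E = ((m == n)%:R)%:E)%E].

Definition orthopoly (R : realType) (u v : R) (w : R -> R) : nat -> {poly R} :=
  xget (fun _ => 0) [set p | orthonormal_polys u v w p].

(* The function rho is represented by the polynomial rpoly = rho ^ (1 + eta):
   eta = false is case (i), rho = rpoly; eta = true is case (ii),
   rho = sqrt rpoly. *)
Definition rho_of (R : realType) (eta : bool) (p : {poly R}) (x : R) : R :=
  if eta then Num.sqrt p.[x] else p.[x].

Record domain (R : realType) := Domain {
  alpha : R;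
  beta : R;
  gam : R;
  del : R;
  eta : bool;
  rpoly : {poly R};
  lt_alpha_beta : alpha < beta;
  lt_gam_del : gam < del;
  rho_gt0 : forall x, alpha < x < beta -> 0 < rho_of eta rpoly x;
  case_ii_sym : eta -> del = - gam /\ 0 < del;
  deg_rpoly : (2 + eta <= (size rpoly).-1)%N
}.

Definition rho (R : realType) (D : domain R) : R -> R :=
  rho_of (eta D) (rpoly D).

Definition rho_sq (R : realType) (D : domain R) : {poly R} :=
  if eta D then rpoly D else rpoly D ^+ 2.

(* rho * rho'; in case (ii), rho rho' = (rho ^ 2)' / 2. *)
Definition rho_rho' (R : realType) (D : domain R) : {poly R} :=
  if eta D then 2^-1 *: (rpoly D)^`() else rpoly D * (rpoly D)^`().

Definition deg_rho_sq (R : realType) (D : domain R) : nat := (size (rho_sq D)).-1.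

(* The degree of rho in case (i). *)
Definition d0 (R : realType) (D : domain R) : nat := (size (rpoly D)).-1.

(* The interior of the domain Omega, where d/dx is taken. *)
Definition inside (R : realType) (D : domain R) (x y : R) : Prop :=
  alpha D < x < beta D /\ gam D * rho D x < y < del D * rho D x.

(* A parameter (a, b, s) of the univariate weights. *)
Definition param (R : realType) : Type := (R * R * R)%type.

Definition wR (R : realType) (D : domain R) (p : param R) (x : R) : R :=
  let: (a, b, s) := p in
  (beta D - x) `^ a * (x - alpha D) `^ b * rho D x `^ s.

Definition Rpol (R : realType) (D : domain R) (p : param R) : nat -> {poly R} :=
  orthopoly (alpha D) (beta D) (wR D p).

Definition wP (R : realType) (D : domain R) (d c y : R) : R :=
  (del D - y) `^ d * (y - gam D) `^ c.

Definition Ppol (R : realType) (D : domain R) (d c : R) : nat -> {poly R} :=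
  orthopoly (gam D) (del D) (wP D d c).

(* The constants are the coefficients in the expansions
     P_n^(d-1,c-1) = r_n P_n^(d,c) - t_(n-1) P_(n-1)^(d,c) - s_(n-2) P_(n-2)^(d,c),
     y P_n^(d,c) = delta_n P_(n+1)^(d,c) + gamma_n P_n^(d,c)
                   + delta_(n-1) P_(n-1)^(d,c),
     (P_(n+1)^(d-1,c-1))' = d_n P_n^(d,c),
   with r, t, s, delta, gamma, d all bearing the superscript (d,c). *)
Definition rJ (R : realType) (D : domain R) (d c : R) (n : nat) : R :=
  coord (Ppol D d c) (Ppol D (d - 1) (c - 1) n) n.

Definition tJ (R : realType) (D : domain R) (d c : R) (n : nat) : R :=
  - coord (Ppol D d c) (Ppol D (d - 1) (c - 1) n.+1) n.

Definition sJ (R : realType) (D : domain R) (d c : R) (n : nat) : R :=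
  - coord (Ppol D d c) (Ppol D (d - 1) (c - 1) n.+2) n.

Definition deltaJ (R : realType) (D : domain R) (d c : R) (n : nat) : R :=
  coord (Ppol D d c) ('X * Ppol D d c n) n.+1.

Definition gammaJ (R : realType) (D : domain R) (d c : R) (n : nat) : R :=
  coord (Ppol D d c) ('X * Ppol D d c n) n.

Definition dJ (R : realType) (D : domain R) (d c : R) (n : nat) : R :=
  coord (Ppol D d c) (Ppol D (d - 1) (c - 1) n.+1)^`() n.

Definition W (R : realType) (D : domain R) (a b c d x y : R) : R :=
  (beta D - x) `^ a * (x - alpha D) `^ b *
  (y - gam D * rho D x) `^ c * (del D * rho D x - y) `^ d.

(* Meaningful for k <= n only. *)
Definition H (R : realType) (D : domain R) (a b c d : R) (n k : nat) (x y : R) : R :=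
  (Rpol D (a, b, c + d + 2 * k%:R + 1) (n - k)%N).[x] * rho D x ^+ k *
  (Ppol D d c k).[y / rho D x].

Definition jacobi (R : realType) (D : domain R) (p : param R) : imatrix R :=
  fun i j => coord (Rpol D p) ('X * Rpol D p j) i.

(* [raising D p q] has the source parameters p as subscript and the target
   parameters q as superscript: R^p = R^q (raising D p q). *)
Definition raising (R : realType) (D : domain R) (p q : param R) : imatrix R :=
  fun i j => coord (Rpol D q) (Rpol D p j) i.

Definition diffmx (R : realType) (D : domain R) (p : param R) : imatrix R :=
  let: (a, b, s) := p in
  fun i j => coord (Rpol D (a + 1, b + 1, s + 1 + (eta D)%:R)) (Rpol D p j)^`() i.

Section Coefficients.
Context (R : realType) (D : domain R) (a b c d : R) (n k m : nat).

Let e : R := (eta D)%:R.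
Let s0 : R := c + d + 2 * k%:R.
Let J : imatrix R := jacobi D (a, b, s0 + 1).

(* For k <= m. *)
Definition cbar_k : R :=
  - rJ D d c k *
  imul (raising D (a, b, s0 + e) (a, b, s0 + 1))
       (diffmx D (a - 1, b - 1, s0 - 1)) (n - k)%N (m - k)%N.

(* For k + 2 <= m. *)
Definition cbar_k2 : R :=
  sJ D d c k *
  imul (imul (ipoly (rho_sq D) J) (diffmx D (a - 1, b - 1, s0 - e)))
       (iinv (raising D (a - 1, b - 1, s0 - e) (a - 1, b - 1, s0 + 3)))
       (n - k)%N (m - k - 2)%N +
  ((k + 2)%:R * sJ D d c k + deltaJ D d c k * dJ D d c k.+1) *
  imul (imul (ipoly (rho_rho' D) J)
             (raising D (a - 1, b - 1, s0 + 1) (a, b, s0 + 1)))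
       (iinv (raising D (a - 1, b - 1, s0 + 1) (a - 1, b - 1, s0 + 3)))
       (n - k)%N (m - k - 2)%N.

(* For k + 1 <= m, in case (i), where rho = rpoly. *)
Definition cbar_k1 : R :=
  tJ D d c k *
  imul (imul (ipoly (rpoly D) J) (diffmx D (a - 1, b - 1, s0)))
       (iinv (raising D (a - 1, b - 1, s0) (a - 1, b - 1, s0 + 1)))
       (n - k)%N (m - k - 1)%N +
  ((k + 1)%:R * tJ D d c k + gammaJ D d c k * dJ D d c k) *
  imul (ipoly (rpoly D)^`() J)
       (raising D (a - 1, b - 1, s0 + 1) (a, b, s0 + 1))
       (n - k)%N (m - k - 1)%N.

End Coefficients.

(* Infinite block matrices whose block (m, n) is of size (m + 1) x (n + 1). *)
Definition block_matrix (R : realType) : Type :=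
  forall m n : nat, 'M[R]_(m.+1, n.+1).

Definition outside_band (l u : int) (i j : nat) : bool :=
  (l < i%:Z - j%:Z) || (u < j%:Z - i%:Z).

Definition bandwidths (R : realType) (p q : nat) (A : 'M[R]_(p, q)) (l u : int) :=
  forall (i : 'I_p) (j : 'I_q), outside_band l u i j -> A i j = 0.

Definition block_bandwidths (R : realType) (B : block_matrix R) (l u : int) :=
  forall m n : nat, outside_band l u m n -> B m n = 0.

(* d/dx W^(a,b,c,d) = W^(a-1,b-1,c-1,d-1) B, as an identity of row vectors in
   the interior of the domain; column (n, k) of B must be finite. *)
Definition weighted_diff (R : realType) (D : domain R) (a b c d : R)
    (B : block_matrix R) : Prop :=
  forall (n : nat) (k : 'I_n.+1), exists N : nat,
    (forall (m : nat) (j : 'I_m.+1), (N <= m)%N -> B m n j k = 0) /\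
    forall x y : R, inside D x y ->
      is_derive x (1 : R) (fun x' => W D a b c d x' y * H D a b c d n k x' y)
        (\sum_(m < N) \sum_(j < m.+1)
           W D (a - 1) (b - 1) (c - 1) (d - 1) x y *
           H D (a - 1) (b - 1) (c - 1) (d - 1) m j x y * B m n j k).

(* Main.v *)
From HB Require Import structures.
From mathcomp Require Import ring lra zify measurable_realfun.
Require Import Defs.
Set Implicit Arguments.
Unset Strict Implicit.
Unset Printing Implicit Defensive.
Local Open Scope classical_set_scope.
Local Open Scope ring_scope.

(** Put [z = y / rho x].  In the coordinates [x] and [z] the weight [W] and the
polynomials [H] are products, so the derivative of [W * H n k] is the weight
with all parameters lowered by one, times [rho x ^+ k], times a combination of
two products of a polynomial in [x] and a polynomial in [z]
([weighted_derive]).  Write [P] for the polynomials with parameters [(d, c)],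
[P'] for those with parameters [(d - 1, c - 1)], [kappa] for
[(del - z) * (z - gam)], and [U] for the polynomial for which [w U] is the
derivative of [w kappa P k], where [w] has parameters [(d - 1, c - 1)].  The
polynomials in [z] are [kappa * P k] and ['X * U].  Both are combinations of
[P' k], [P' k.+1] and [P' k.+2] ([kappaP_expand], [XU_expand]): their
coordinates are found by integration by parts, and the outermost ones by
comparing leading coefficients.  This gives the three families of terms.  The
coefficient of [P' k.+2] in ['X * U] is [- (c + d + k) s_k]; it makes the
polynomial in [x] that multiplies [P' k.+2] divisible by [rho ^+ 2] and so keeps
the degrees in the second sum low.  Computed by parts, the same coefficient
is [s_k - delta_k d_(k+1)], and the comparison ([delta_d]) brings the second sum
into the form of the statement.  In case (ii) the polynomials [P]
and [P'] are even or odd, whence [t_k = gamma_k = 0] ([t_sym], [gamma_sym]) and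
the terms with [P' k.+1] disappear.

It remains to expand the polynomial in [x] that multiplies each [P'] in the
orthonormal polynomials [R] that belong to it ([expand_k], [expand_k2],
[expand_k1]).  A coordinate is an integral against some [R i]; the derivative is
moved onto [R i] by parts, and the weight that is left over is the one of
parameters [(a, b, c + d + 2k + 1)].  So the coordinate is itself a coordinate
of [f * (R i)^`()] or [f * R i], for a fixed polynomial [f], with respect to
the polynomials of these parameters.  The matrices in the statement are the
matrices of multiplication by a polynomial, of differentiation and of the
identity in suitable bases, and products of matrices correspond to composition
([imul_opmx]); hence the formulas ([cbar_kE], [cbar_k2E], [cbar_k1E]).  The
upper limits of the sums come from the degrees of the expanded polynomials, the
lower limits from orthogonality.

All the integrals that occur are values of positive linear functionals on
polynomials.  Analysis is needed for three facts only: the weights are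
positive and integrable, they are related to each other by polynomial factors
([represents_mul]), and the integral of a derivative vanishes when the
primitive tends to 0 at both ends ([integral_derive0]).

The entries of the differentiation matrix are the coefficients found in this
way; they are the only ones because the polynomials [H] are linearly independent
on the interior of the domain ([H_independent]). *)

(** * Coordinates with respect to a graded sequence of polynomials *)

Section Graded.
Context {R : realType}.
Implicit Types (p q r : nat -> {poly R}) (f g : {poly R}).

Definition graded q := forall n, size (q n) = n.+1.

(** By induction on the degree: subtracting the right multiple of [q n] removes the
leading term.  The sizes are only assumed below [n] because the Gram-Schmidt
process applies this to a sequence that is not yet complete. *)
Lemma graded_expand q n f :
  (forall i, (i < n)%N -> size (q i) = i.+1) -> (size f <= n)%N ->
  exists c : nat -> R, f = \sum_(i < n) c i *: q i.
Proof.
elim: n f => [|n IHn] f sq sf.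
  by exists (fun=> 0); move: sf; rewrite leqn0 size_poly_eq0 big_ord0 => /eqP.
have qn0 : lead_coef (q n) != 0 by rewrite lead_coef_eq0 -size_poly_eq0 sq.
pose l := f`_n / lead_coef (q n).
have sfl : (size (f - l *: q n)%R <= n)%N.
  apply/leq_sizeP => j; rewrite leq_eqVlt => /predU1P[<-|nj].
    rewrite coefB coefZ.
    have -> : (q n)`_n = lead_coef (q n) by rewrite lead_coefE sq.
    by rewrite divfK// subrr.
  rewrite coefB coefZ !nth_default ?mulr0 ?subrr//; first by rewrite sq.
  exact: leq_trans sf nj.
have [c fc] := IHn _ (fun i ilt => sq i (ltnW ilt)) sfl.
exists (fun i => if i == n then l else c i).
rewrite big_ord_recr/= eqxx -[LHS](subrK (l *: q n)) {1}fc; congr (_ + _).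
by apply: eq_bigr => i _; rewrite ltn_eqF.
Qed.

Lemma graded_free q n (c : nat -> R) : graded q ->
  \sum_(i < n) c i *: q i = 0 -> forall i, (i < n)%N -> c i = 0.
Proof.
move=> gq; elim: n => [//|n IHn]; rewrite big_ord_recr/= => s0.
have lt_s : (size (\sum_(i < n) c i *: q i)%R <= n)%N.
  rewrite (leq_trans (size_sum _ _ _))//; apply/bigmax_leqP => i _.
  by rewrite (leq_trans (size_scale_leq _ _))// gq.
have cn0 : c n = 0.
  have := congr1 (fun f : {poly R} => f`_n) s0; rewrite coefD coefZ coef0.
  rewrite (nth_default _ lt_s) add0r => /eqP; rewrite mulf_eq0 => /orP[/eqP//|].
  have -> : (q n)`_n = lead_coef (q n) by rewrite lead_coefE gq.
  by rewrite lead_coef_eq0 -size_poly_eq0 gq.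
move=> i; rewrite ltnS leq_eqVlt => /predU1P[->//|]; apply: IHn.
by move: s0; rewrite cn0 scale0r addr0.
Qed.

Lemma graded_inj q N M (c e : nat -> R) : graded q ->
  (forall i, (N <= i)%N -> c i = 0) -> (forall i, (M <= i)%N -> e i = 0) ->
  \sum_(i < N) c i *: q i = \sum_(i < M) e i *: q i -> c = e.
Proof.
move=> gq.
have widen (h : nat -> R) K L : (K <= L)%N -> (forall i, (K <= i)%N -> h i = 0) ->
    \sum_(i < K) h i *: q i = \sum_(i < L) h i *: q i.
  move=> KL hK; rewrite (big_ord_widen L (fun i => h i *: q i) KL).
  by rewrite big_mkcond; apply: eq_bigr => i _; case: ltnP => // /hK ->; rewrite scale0r.
move=> cN eM; rewrite (widen _ _ _ (leq_maxl N M) cN) (widen _ _ _ (leq_maxr N M) eM).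
move=> /eqP; rewrite -subr_eq0 -sumrB => /eqP s0; apply/funext => i.
have [iNM|] := ltnP i (maxn N M); last first.
  by rewrite geq_max => /andP[/cN -> /eM ->].
apply/eqP; rewrite -subr_eq0; apply/eqP.
apply: (graded_free (c := fun i => c i - e i) gq _ iNM).
by rewrite -[RHS]s0; apply: eq_bigr => j _; rewrite scalerBl.
Qed.

Lemma coord_unique q N f (c : nat -> R) : graded q ->
  (forall i, (N <= i)%N -> c i = 0) -> f = \sum_(i < N) c i *: q i ->
  coord q f = c.
Proof.
move=> gq cN fc; rewrite /coord; case: xgetP => [e _ [M [eM fe]]|/(_ c) []].
  by apply: (graded_inj gq eM cN); rewrite -fe.
by exists N.
Qed.

(** The expansion of [graded_expand], cut off at [size f], satisfies the description
that [coord] chooses from, and [coord_unique] says that nothing else does. *)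
Lemma coord_spec q f : graded q ->
  (forall i, (size f <= i)%N -> coord q f i = 0) /\
  f = \sum_(i < size f) coord q f i *: q i.
Proof.
move=> gq; have [c fc] := @graded_expand q (size f) f (fun i _ => gq i) (leqnn _).
pose e i := if (i < size f)%N then c i else 0.
have fe : f = \sum_(i < size f) e i *: q i.
  by rewrite {1}fc; apply: eq_bigr => i _; rewrite /e ltn_ord.
have e0 i : (size f <= i)%N -> e i = 0 by rewrite /e ltnNge => ->.
by rewrite (coord_unique gq e0 fe).
Qed.

Lemma coord_oversize q f i : graded q -> (size f <= i)%N -> coord q f i = 0.
Proof. by move=> gq; apply: (coord_spec f gq).1. Qed.

Lemma coord_sum q f N : graded q -> (size f <= N)%N ->
  f = \sum_(i < N) coord q f i *: q i.
Proof.
move=> gq fN; have [c0 {1}->] := coord_spec f gq.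
rewrite (big_ord_widen N (fun i => coord q f i *: q i) fN).
rewrite big_mkcond; apply: eq_bigr => i _.
by case: ltnP => // /c0 ->; rewrite scale0r.
Qed.

Lemma coord_linear q l f g i : graded q ->
  coord q (l *: f + g) i = l * coord q f i + coord q g i.
Proof.
move=> gq; pose N := maxn (size f) (size g).
rewrite (@coord_unique q N _ (fun i => l * coord q f i + coord q g i))//.
  by move=> j; rewrite geq_max => /andP[fj gj]; rewrite !coord_oversize// mulr0 addr0.
transitivity (l *: (\sum_(i < N) coord q f i *: q i) +
              \sum_(i < N) coord q g i *: q i).
  by rewrite -!coord_sum ?leq_maxl ?leq_maxr.
rewrite scaler_sumr -big_split/=.
by apply: eq_bigr => j _; rewrite scalerDl scalerA.
Qed.

Lemma coord0 q i : graded q -> coord q 0 i = 0.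
Proof. by move=> gq; rewrite coord_oversize// size_poly0. Qed.

Lemma coordZ q l f i : graded q -> coord q (l *: f) i = l * coord q f i.
Proof. by move=> gq; rewrite -[l *: f]addr0 coord_linear// coord0// addr0. Qed.

Lemma coordD q f g i : graded q -> coord q (f + g) i = coord q f i + coord q g i.
Proof. by move=> gq; rewrite -[f in LHS]scale1r coord_linear// mul1r. Qed.

Lemma coord_big q n (c : 'I_n -> R) (F : 'I_n -> {poly R}) i : graded q ->
  coord q (\sum_l c l *: F l) i = \sum_l c l * coord q (F l) i.
Proof.
move=> gq; elim/big_rec2: _ => [|l x f _ <-]; first exact: coord0.
by rewrite coord_linear.
Qed.

Lemma coord_basis q j i : graded q -> coord q (q j) i = (i == j)%:R.
Proof.
move=> gq; rewrite (@coord_unique q j.+1 _ (fun i => (i == j)%:R))//.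
  by move=> l; case: eqP => // ->; rewrite ltnn.
rewrite big_ord_recr/= eqxx scale1r big1 ?add0r// => l _.
by rewrite ltn_eqF// scale0r.
Qed.

(** The matrix of the operator [phi] with respect to the basis [p] of its source and
the basis [q] of its target.  Raising matrices, differentiation matrices and
Jacobi matrices are all of this form. *)
Definition opmx q p (phi : {poly R} -> {poly R}) : imatrix R :=
  fun i j => coord q (phi (p j)) i.

Lemma imul_finite (A B : imatrix R) i j N :
  (forall l, (N <= l)%N -> A i l * B l j = 0) ->
  imul A B i j = \sum_(l < N) A i l * B l j.
Proof.
move=> AB0; rewrite /imul (fsbig_ord _ N (fun l => A i l * B l j)).
apply/esym/fsbig_widen => // l [_ /= /negP]; rewrite -leqNgt; exact: AB0.
Qed.

(** The matrix of a composition is the product of the matrices.  The sums that define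
this product are finite because a polynomial has finitely many coordinates. *)
Lemma imul_opmx r q p phi psi : graded r -> graded q -> linear phi ->
  imul (opmx r q phi) (opmx q p psi) = opmx r p (phi \o psi).
Proof.
move=> gr gq lphi; apply/funext => i; apply/funext => j.
have [N sN] : exists N, (size (psi (p j)) <= N)%N by exists (size (psi (p j))).
rewrite (@imul_finite _ _ _ _ N); last first.
  by move=> l sl; rewrite /opmx [X in _ * X]coord_oversize ?mulr0// (leq_trans sN).
rewrite /opmx/=; move: (psi (p j)) sN => g sN.
pose phiL := GRing.isLinear.Build _ _ _ _ phi lphi.
pose L : {linear {poly R} -> {poly R}} := HB.pack phi phiL.
transitivity (coord r (L (\sum_(l < N) coord q g l *: q l)) i); last first.
  by rewrite -coord_sum.
rewrite linear_sum; under [in RHS]eq_bigr do rewrite linearZ.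
by rewrite coord_big//; apply: eq_bigr => l _; rewrite mulrC.
Qed.

Lemma opmx_id q : graded q -> opmx q q id = iid R.
Proof. by move=> gq; apply/funext=> i; apply/funext=> j; rewrite /opmx coord_basis. Qed.

Lemma linear_idp : linear (@id {poly R}).
Proof. by []. Qed.

Lemma linear_mul_deriv f : linear (fun g : {poly R} => f * g^`()).
Proof. by move=> l g h /=; rewrite derivD derivZ mulrDr scalerAr. Qed.

Lemma linear_mulp f : linear (fun g => f * g).
Proof. by move=> l g h; rewrite mulrDr scalerAr. Qed.

Lemma ipow_opmx q n : graded q ->
  ipow (opmx q q (fun g => 'X * g)) n = opmx q q (fun g => 'X^n * g).
Proof.
move=> gq; elim: n => [|n IHn].
  by rewrite -[LHS]/(iid R) -(opmx_id gq); congr opmx; apply/funext => g; rewrite mul1r.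
rewrite /ipow iterS -/(ipow _ n) IHn imul_opmx//; last exact: linear_mulp.
by congr opmx; apply/funext => g /=; rewrite exprS mulrA.
Qed.

Lemma ipoly_opmx q f : graded q ->
  ipoly f (opmx q q (fun g => 'X * g)) = opmx q q (fun g => f * g).
Proof.
move=> gq; apply/funext => i; apply/funext => j; rewrite /ipoly.
under eq_bigr do rewrite ipow_opmx// /opmx.
rewrite -(@coord_big _ _ (fun l : 'I_(size f) => f`_l))//.
rewrite /opmx; congr (coord q _ i).
rewrite -[in RHS](coefK f) poly_def mulr_suml.
by apply: eq_bigr => l _; rewrite scalerAl.
Qed.

(** Changing the basis back is a two-sided inverse, and it is upper triangular.  It is
the only possible choice: any [B] with [B A = 1] is [B (A A') = (B A) A' = A'],
where [A'] is the change back.  Products of infinite matrices are not associative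
in general; here the columns of [A] and [A'] are finite, so that the double sum
can be exchanged. *)
Lemma iinv_opmx p q : graded p -> graded q ->
  iinv (opmx q p id) = opmx p q id.
Proof.
move=> gp gq; have lid : linear (id : {poly R} -> {poly R}) by [].
rewrite /iinv; case: xgetP => [B _ [_ _ BA]|/(_ (opmx p q id)) []]; last first.
  split; last by rewrite imul_opmx// opmx_id.
    by move=> i j ji; rewrite /opmx coord_oversize// gq.
  by rewrite imul_opmx// opmx_id.
apply/funext => i; apply/funext => j.
(* Left-hand side: entry of [B (A A')]; right-hand side: entry of [(B A) A']. *)
transitivity (\sum_(m < j.+1) (\sum_(l < m.+1) B i l * opmx q p id l m) * opmx p q id m j).
  transitivity (\sum_(l < j.+1) B i l * (l == j :> nat)%:R).
    rewrite big_ord_recr/= eqxx mulr1 big1 ?add0r// => l _.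
    by rewrite ltn_eqF// mulr0.
  transitivity (\sum_(l < j.+1) B i l * (\sum_(m < j.+1) opmx q p id l m * opmx p q id m j)).
    apply: eq_bigr => l _; congr (_ * _); rewrite -(@imul_finite _ _ l j).
      by rewrite imul_opmx// opmx_id.
    by move=> m jm; rewrite /opmx [X in _ * X]coord_oversize ?gq// mulr0.
  under eq_bigr do rewrite big_distrr/=.
  rewrite exchange_big/=; apply: eq_bigr => m _; rewrite big_distrl/=.
  rewrite (big_ord_widen j.+1 (fun l => B i l * opmx q p id l m * opmx p q id m j)) ?ltn_ord//.
  rewrite [RHS]big_mkcond/=; apply: eq_bigr => l _; rewrite mulrA.
  by case: ltnP => // ml; rewrite /opmx coord_oversize ?gp// mulr0 mul0r.
rewrite big_ord_recr/=.
transitivity (\sum_(m < j.+1) (i == m)%:R * opmx p q id m j).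
  have E m : \sum_(l < m.+1) B i l * opmx q p id l m = (i == m)%:R.
    rewrite -imul_finite ?BA// => l ml.
    by rewrite /opmx [X in _ * X]coord_oversize ?gp// mulr0.
  by rewrite [RHS]big_ord_recr/=; under eq_bigr do rewrite E; rewrite E.
have [ij|ji] := ltnP i j.+1.
  rewrite (bigD1 (Ordinal ij))//= eqxx mul1r big1 ?addr0// => m.
  by rewrite -val_eqE/= eq_sym => /negPf ->; rewrite mul0r.
rewrite big1 => [|m _]; first by rewrite /opmx coord_oversize// gq.
by rewrite gtn_eqF ?mul0r//; apply: leq_trans ji.
Qed.

Lemma imul_mul_deriv_raise q1 qm q2 f : graded q1 -> graded qm -> graded q2 ->
  imul (imul (ipoly f (opmx q1 q1 (fun g => 'X * g))) (opmx q1 qm (fun g => g^`())))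
       (iinv (opmx q2 qm id)) = opmx q1 q2 (fun g => f * g^`()).
Proof.
move=> g1 gm g2; rewrite ipoly_opmx// iinv_opmx// imul_opmx//; last exact: linear_mulp.
by rewrite imul_opmx//; exact: linear_mul_deriv.
Qed.

Lemma imul_mul_raise q1 qm f : graded q1 ->
  imul (ipoly f (opmx q1 q1 (fun g => 'X * g))) (opmx q1 qm id) =
  opmx q1 qm (fun g => f * g).
Proof. by move=> g1; rewrite ipoly_opmx// imul_opmx//; exact: linear_mulp. Qed.

Lemma imul_mul_raise2 q1 qm q2 f : graded q1 -> graded qm -> graded q2 ->
  imul (imul (ipoly f (opmx q1 q1 (fun g => 'X * g))) (opmx q1 qm id))
       (iinv (opmx q2 qm id)) = opmx q1 q2 (fun g => f * g).
Proof.
move=> g1 gm g2; rewrite imul_mul_raise// iinv_opmx// imul_opmx//.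
exact: linear_mulp.
Qed.

End Graded.

(** * Orthonormal polynomials of a positive functional *)

Section Functional.
Context {R : realType}.
Implicit Types (L : {scalar {poly R}}) (p q : nat -> {poly R}) (f g : {poly R}).

Definition posdef L := forall f, f != 0 -> 0 < L (f * f).

Definition orthonormal L p :=
  [/\ graded p, forall n, 0 < lead_coef (p n) &
      forall m n, L (p m * p n) = (m == n)%:R].

(** Gram-Schmidt: ['X^n] minus its projection on the previous polynomials, divided by
its norm, which is not 0 because the functional is positive. *)
Lemma orthonormal_exists L : posdef L -> exists p, orthonormal L p.
Proof.
move=> posL.
pose Q n g := [/\ size g = n.+1, 0 < lead_coef g, L (g * g) = 1 &
  forall f, (size f <= n)%N -> L (f * g) = 0].
suff /choice[p Qp] : forall n, exists g, Q n g.
  exists p; split=> [n|n|m n]; [by case: (Qp n)|by case: (Qp n)|].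
  case: (ltngtP m n) => [mn|nm|->]; last by case: (Qp n).
  - by have [_ _ _ ->//] := Qp n; have [-> _ _ _] := Qp m.
  - by rewrite mulrC; have [_ _ _ ->//] := Qp m; have [-> _ _ _] := Qp n.
elim/ltn_ind => n IHn.
pose q m := xget 0 [set g | Q m g].
have Qq m : (m < n)%N -> Q m (q m).
  by move=> /IHn[g Qg]; apply: (@xgetPex _ (0 : {poly R}) [set g | Q m g]); exists g.
have Lq i j : (i < n)%N -> (j < n)%N -> L (q i * q j) = (i == j)%:R.
  move=> /Qq[si _ Li1 Li] /Qq[sj _ _ Lj].
  case: (ltngtP i j) => [ij|ji|eij]; last by rewrite -eij.
  - by rewrite Lj// si.
  - by rewrite mulrC Li// sj.
pose h := \sum_(m < n) L ('X^n * q m) *: q m.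
(* [h] is the projection of ['X^n] on the polynomials of degree less than [n]. *)
pose g := 'X^n - h.
have sh : (size (- h)%R < size ('X^n : {poly R}))%N.
  rewrite size_polyN size_polyXn ltnS (leq_trans (size_sum _ _ _))//.
  apply/bigmax_leqP => i _; rewrite (leq_trans (size_scale_leq _ _))//.
  by have [->] := Qq i (ltn_ord i).
have sg : size g = n.+1 by rewrite size_polyDl// size_polyXn.
have lg : lead_coef g = 1 by rewrite lead_coefDl// lead_coefXn.
have g0 : g != 0 by rewrite -size_poly_eq0 sg.
have Lg f : (size f <= n)%N -> L (f * g) = 0.
  move=> sf; have [|c ->] := @graded_expand R q n f _ sf; first by move=> i /Qq[].
  rewrite mulr_suml linear_sum big1// => i _.
  rewrite -scalerAl linearZ/= mulrBr linearB/= mulr_sumr linear_sum/=.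
  rewrite (bigD1 i)//= big1 => [|m mi]; last first.
    by rewrite -scalerAr linearZ/= Lq// eq_sym val_eqE (negPf mi) mulr0.
  by rewrite -scalerAr linearZ/= Lq// eqxx mulr1 addr0 [q i * 'X^n]mulrC subrr mulr0.
have Lgg := posL _ g0.
have r0 : 0 < (Num.sqrt (L (g * g)))^-1 by rewrite invr_gt0 sqrtr_gt0.
exists ((Num.sqrt (L (g * g)))^-1 *: g); split.
- by rewrite size_scale// gt_eqF.
- by rewrite lead_coefZ lg mulr1.
- rewrite -scalerAl -scalerAr scalerA linearZ/= -expr2 exprVn sqr_sqrtr ?ltW//.
  by rewrite mulVf// gt_eqF.
- by move=> f sf; rewrite -scalerAr linearZ/= (Lg _ sf) mulr0.
Qed.

Lemma coord_orthonormal L p f i : orthonormal L p -> coord p f i = L (f * p i).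
Proof.
move=> [gp _ Lp]; have [N sN] : exists N, (size f <= N)%N by exists (size f).
rewrite [in RHS](coord_sum gp sN) mulr_suml linear_sum/=.
under eq_bigr do rewrite -scalerAl linearZ/= Lp.
have [iN|Ni] := ltnP i N.
  rewrite (bigD1 (Ordinal iN))//= eqxx mulr1 big1 ?addr0// => m.
  by rewrite -val_eqE/= => /negPf ->; rewrite mulr0.
rewrite coord_oversize ?(leq_trans sN)// big1// => m _.
by rewrite ltn_eqF ?mulr0// (leq_trans _ Ni).
Qed.

Lemma orthonormal_low L p f i : orthonormal L p -> (size f <= i)%N ->
  L (f * p i) = 0.
Proof.
by move=> op sf; rewrite -coord_orthonormal// coord_oversize//; case: op.
Qed.

Lemma orthonormal_expand L p f N : orthonormal L p -> (size f <= N)%N ->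
  f = \sum_(i < N) L (f * p i) *: p i.
Proof.
move=> op sf; have [gp _ _] := op; rewrite {1}(coord_sum gp sf).
by apply: eq_bigr => i _; rewrite (coord_orthonormal _ _ op).
Qed.

(** On polynomials of degree at most [n], pairing with [p n] only sees the coefficient of
['X^n]. *)
Lemma orthonormal_top L p f g n l : orthonormal L p ->
  (size f <= n.+1)%N -> (size g <= n.+1)%N -> f`_n = l * g`_n ->
  L (f * p n) = l * L (g * p n).
Proof.
move=> op sf sg fg; apply/eqP; rewrite -subr_eq0 -linearZ -linearB/=.
rewrite scalerAl -mulrBl (orthonormal_low op)//; apply/leq_sizeP => j.
rewrite leq_eqVlt => /predU1P[<-|nj]; rewrite coefB coefZ ?fg ?subrr//.
by rewrite !nth_default ?mulr0 ?subrr// ?(leq_trans sf)// (leq_trans sg).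
Qed.

End Functional.

(** * Integrals of derivatives over an open interval *)

Section Improper.
Context {R : realType}.
Variables (u v : R).
Hypothesis uv : u < v.
Notation mu := (@lebesgue_measure R).

(* The denominator starts at 3 so that [E 0] already is a nondegenerate interval. *)
Let h n : R := (v - u) / n.+3%:R.
Let E n : set R := `[u + h n, v - h n].

Let h_gt0 n : 0 < h n. Proof. by rewrite divr_gt0 ?subr_gt0. Qed.

Let h_lt n : u + h n < v - h n.
Proof.
have n3 : (3 : R) <= n.+3%:R by rewrite ler_nat.
have : h n * n.+3%:R = v - u by rewrite divfK// pnatr_eq0.
have := h_gt0 n; nra.
Qed.

Let h_cvg : h n @[n --> \oo] --> 0.
Proof.
rewrite -[X in _ --> X](mulr0 (v - u)).
apply: cvgM; first exact: cvg_cst.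
by have := @cvg_harmonic R; rewrite -(cvg_shiftn 2); under eq_fun do rewrite addn2.
Qed.

Let E_nondecr : nondecreasing_seq E.
Proof.
move=> m n mn; rewrite subsetEset; have hmn : h n <= h m.
  by rewrite /h ler_pM2l ?subr_gt0// lef_pV2 ?posrE// ler_nat !ltnS.
by apply: subset_itvScc; rewrite bnd_simp ?lerD2l ?lerN2.
Qed.

Let E_sub n : E n `<=` `]u, v[.
Proof.
move=> x; rewrite /E/= !in_itv/= => /andP[ux xv]; apply/andP; split.
- by apply: lt_le_trans ux; rewrite ltrDl.
- by apply: le_lt_trans xv _; rewrite gtrBl.
Qed.

Let E_bigcup : \bigcup_n E n = `]u, v[%classic.
Proof.
apply/seteqP; split=> [x [n _ /E_sub//]|x /=]; rewrite in_itv/= => /andP[ux xv].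
have d0 : 0 < Num.min (x - u) (v - x) by rewrite lt_min !subr_gt0 ux xv.
have /cvgr_lt/(_ _ d0)[N _ /(_ N (leqnn _))/=] := h_cvg.
rewrite lt_min => /andP[a b]; exists N => //; rewrite /E/= in_itv/=; apply/andP; split; lra.
Qed.

Variables (F f : R -> R).
Hypothesis dF : forall x, u < x < v -> is_derive x 1 F (f x).
Hypothesis cf : forall x, u < x < v -> {for x, continuous f}.

Let int_E n : (\int[mu]_(x in E n) (f x)%:E = (F (v - h n) - F (u + h n))%:E)%E.
Proof.
have sub x : u + h n <= x <= v - h n -> u < x < v.
  by move=> xE; have := @E_sub n x; rewrite /E/= !in_itv/=; exact.
have lE : u + h n <= u + h n <= v - h n by rewrite lexx ltW.
have rE : u + h n <= v - h n <= v - h n by rewrite lexx ltW.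
have drF x : u + h n <= x <= v - h n -> derivable F x 1.
  by move=> /sub/dF[].
have cF x : u + h n <= x <= v - h n -> {for x, continuous F}.
  by move=> /drF/derivable1_diffP; exact: differentiable_continuous.
rewrite EFinB; apply: continuous_FTC2; first exact: h_lt.
- apply: continuous_in_subspaceT => x; rewrite inE/= in_itv/= => /sub; exact: cf.
- split.
  + by move=> x; rewrite in_itv/= => /andP[ux xv]; apply: drF; rewrite !ltW.
  + by apply: cvg_at_right_filter; exact: cF.
  + by apply: cvg_at_left_filter; exact: cF.
- move=> x; rewrite in_itv/= => /andP[ux xv]; rewrite derive1E.
  have /sub/dF[_ ->//] : u + h n <= x <= v - h n by rewrite !ltW.
Qed.

Let mf : measurable_fun `]u, v[ f.
Proof.
apply: open_continuous_measurable_fun => // x; rewrite inE/= in_itv/=; exact: cf.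
Qed.

Let mfE (g : R -> \bar R) : measurable_fun `]u, v[ g -> forall i, measurable_fun (E i) g.
Proof. by move=> mg i; apply: measurable_funS mg => //; exact: E_sub. Qed.

(** Over compact subintervals the integral is a difference of values of [F], hence at
most [K + K]; monotone convergence carries the bound over to the whole interval.  The
integrand may be unbounded at the ends, as powers with a negative exponent are. *)
Lemma derive_ge0_integrable K : (forall x, u < x < v -> 0 <= f x) ->
  (forall x, u < x < v -> `|F x| <= K) -> mu.-integrable `]u, v[ (EFin \o f).
Proof.
move=> f0 FK; apply/integrableP; split; first exact/measurable_EFinP.
have f0' (x : R) : `]u, v[%classic x -> (0 <= (f x)%:E)%E.
  by rewrite /= in_itv/= lee_fin; exact: f0.
under eq_integral => x /set_mem xuv do rewrite /= ger0_norm -?lee_fin ?f0'//.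
have : (\int[mu]_(x in \bigcup_n E n) (f x)%:E <= (K + K)%:E)%E.
  apply: (@closed_cvg _ _ (nbhs \oo) _ (fun n => \int[mu]_(x in E n) (f x)%:E)%E
     [set y | (y <= (K + K)%:E)%E]).
  - exact: closed_ereal_ge_ereal.
  - near=> n; rewrite /= int_E lee_fin.
    have inE x : E n x -> u < x < v by move=> /E_sub; rewrite /= in_itv.
    have lE : E n (u + h n) by rewrite /E/= in_itv/= lexx ltW.
    have rE : E n (v - h n) by rewrite /E/= in_itv/= lexx ltW.
    have := FK _ (inE _ rE); have := FK _ (inE _ lE).
    by rewrite !ler_norml => /andP[a _] /andP[_ b]; lra.
  - apply: ge0_nondecreasing_set_cvg_integral => //.
    + by move=> n; exact: measurable_itv.
    + by apply: mfE; exact/measurable_EFinP.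
    + by move=> n x /E_sub; exact: f0'.
by rewrite E_bigcup => /le_lt_trans; apply; rewrite ltry.
Unshelve. all: by end_near. Qed.

(** The integral over the compact subintervals [E n] is [F (v - h n) - F (u + h n)], which
tends to 0.  It also tends to the integral over the whole interval, since
this holds for the positive and the negative parts. *)
Lemma integral_derive0 : mu.-integrable `]u, v[ (EFin \o f) ->
  F x @[x --> u^'+] --> 0 -> F x @[x --> v^'-] --> 0 ->
  (\int[mu]_(x in `]u, v[) (f x)%:E = 0)%E.
Proof.
move=> intf Fu Fv.
have cint (g : R -> \bar R) : measurable_fun `]u, v[ g ->
    (forall x, `]u, v[%classic x -> 0 <= g x)%E ->
    (\int[mu]_(x in E n) g x @[n --> \oo] --> \int[mu]_(x in `]u, v[) g x)%E.
  move=> mg g0; rewrite -E_bigcup; apply: ge0_nondecreasing_set_cvg_integral => //.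
  + by move=> n; exact: measurable_itv.
  + exact: mfE.
  + by move=> n x /E_sub; exact: g0.
have mEf : measurable_fun `]u, v[ (EFin \o f) by exact/measurable_EFinP.
have Ip := cint _ (measurable_funepos mEf) (fun x _ => funepos_ge0 _ x).
have In := cint _ (measurable_funeneg mEf) (fun x _ => funeneg_ge0 _ x).
have finp : (\int[mu]_(x in `]u, v[) (EFin \o f)^\+ x)%E \is a fin_num.
  exact: integrable_pos_fin_num.
have cI := cvgeB (fin_num_adde_defr _ finp) Ip In.
have cF : (fun n => F (v - h n) - F (u + h n)) @ \oo --> (0 : R).
  rewrite -[X in _ --> X](subrr 0); apply: cvgB.
  - apply: (cvg_at_leftP F v 0).1 => //; split=> [n|]; first by rewrite gtrBl.
    by rewrite -[X in _ --> X]subr0; apply: cvgB => //; exact: cvg_cst.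
  - apply: (cvg_at_rightP F u 0).1 => //; split=> [n|]; first by rewrite ltrDl.
    by rewrite -[X in _ --> X]addr0; apply: cvgD => //; exact: cvg_cst.
rewrite integralE -(cvg_lim _ (cI _))//; apply: cvg_lim => //.
under eq_cvg do rewrite -integralE int_E.
by apply: cvg_EFin => //; exact: nearW.
Qed.

End Improper.

(** * Weights and the functionals that they define *)

Section Polynomials.
Context {R : realType}.
Implicit Types (f g : {poly R}).

Lemma horner_bounded (u v : R) f :
  exists2 M, 0 < M & forall x, u <= x <= v -> `|f.[x]| <= M.
Proof.
elim/poly_ind: f => [|f c [M M0 fM]].
  by exists 1 => // x _; rewrite horner0 normr0.
pose B := `|u| + `|v|.
exists (M * B + `|c| + 1) => [|x uxv].
  have : 0 <= M * B by rewrite mulr_ge0 ?(ltW M0)// addr_ge0.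
  by have := normr_ge0 c; lra.
rewrite !hornerE ler_wpDr// (le_trans (ler_normD _ _))// lerD2r normrM.
apply: ler_pM => //; first exact: fM.
have := ler_norm v; have := ler_norm (- u); rewrite normrN => *.
have := normr_ge0 u; have := normr_ge0 v => *.
by rewrite /B ler_norml; case/andP: uxv => *; apply/andP; split; lra.
Qed.

Lemma poly_finite_roots f : f != 0 -> exists s : seq R, forall x, root f x -> x \in s.
Proof.
have [n] := ubnP (size f); elim: n f => // n IHn f; rewrite ltnS => sf f0.
have [[a fa]|nr] := pselect (exists a, root f a); last first.
  by exists [::] => x fx; case: nr; exists x.
have /factor_theorem[g fg] := fa.
have g0 : g != 0 by apply: contraNneq f0 => g0; rewrite fg g0 mul0r.
have [|//|s gs] := IHn g.
  rewrite (leq_trans _ sf)// fg size_Mmonic ?monicXsubC// size_XsubC addn2/=.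
  by [].
(* Divide by a linear factor at a root; the quotient has one degree less. *)
exists (a :: s) => x; rewrite fg rootM root_XsubC inE orbC.
by case/orP => [->//|/gs ->]; rewrite orbT.
Qed.

Lemma itv_not_negligible (u v : R) : u < v ->
  ~ (@lebesgue_measure R).-negligible `]u, v[.
Proof.
move=> uv [N [mN N0 uvN]].
have : (lebesgue_measure (`]u, v[%classic : set R) <= lebesgue_measure N)%E.
  by apply: le_measure => //; rewrite inE//; exact: measurable_itv.
rewrite N0 lebesgue_measure_itv/= lte_fin uv lee_fin leNgt => /negP; apply.
by rewrite subr_gt0.
Qed.

Lemma seq_negligible (s : seq R) : (@lebesgue_measure R).-negligible [set` s].
Proof.
have cs : countable [set` s] by exact: finite_set_countable.
apply/negligibleP; last exact: countable_lebesgue_measure0.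
by apply: countable_measurable => // t; exact: measurable_set1.
Qed.

(** A finite set of roots is negligible, and an interval is not. *)
Lemma poly_itv_eq0 (u v : R) f : u < v -> (forall x, u < x < v -> f.[x] = 0) -> f = 0.
Proof.
move=> uv f0; apply/eqP; apply: contraT => /poly_finite_roots[s fs].
case: (itv_not_negligible uv); apply: negligibleS (seq_negligible s) => x.
by rewrite /= in_itv/= => /f0/eqP/fs.
Qed.

End Polynomials.

Section Weights.
Context {R : realType}.
Variables (u v : R).
Hypothesis uv : u < v.
Notation mu := (@lebesgue_measure R).
Implicit Types (w : R -> R) (f g : {poly R}).

Definition positive_weight w :=
  mu.-integrable `[u, v] (EFin \o w) /\ forall x, u < x < v -> 0 < w x.

Definition represents w (L : {scalar {poly R}}) :=
  forall f, (\int[mu]_(x in `[u, v]) (f.[x] * w x)%:E = (L f)%:E)%E.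

Lemma measurable_horner (A : set R) f : measurable_fun A (horner f).
Proof.
by apply: measurable_funTS; apply: continuous_measurable_fun; exact: continuous_horner.
Qed.

Lemma integrable_horner w f : mu.-integrable `[u, v] (EFin \o w) ->
  mu.-integrable `[u, v] (EFin \o (fun x => f.[x] * w x)).
Proof.
move=> wi; have [M M0 fM] := horner_bounded u v f.
rewrite (_ : EFin \o _ = ((EFin \o horner f) \* (EFin \o w))%E)//.
apply: integrableMr => //; first exact: measurable_horner.
exists M; split; first exact: num_real.
by move=> N MN x; rewrite /= in_itv/= => /fM/le_trans; apply; exact: ltW.
Qed.

Lemma functional_exists w : mu.-integrable `[u, v] (EFin \o w) -> exists L, represents w L.
Proof.
move=> wi; pose L f := \int[mu]_(x in `[u, v]) (f.[x] * w x).
have linL : scalar L.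
  move=> l f g; rewrite /L -RintegralZl//; last exact: integrable_horner.
  rewrite -RintegralD//; last 2 first.
  - have := integrable_horner (l *: f) wi; apply: eq_integrable => // x _ /=.
    by rewrite hornerZ mulrA.
  - exact: integrable_horner.
  by apply: eq_Rintegral => x _; rewrite hornerD hornerZ mulrDl mulrA.
pose LL := GRing.isLinear.Build _ _ _ _ L linL.
exists (HB.pack L LL : {scalar {poly R}}) => f /=.
by rewrite /L fineK//; apply: integrable_fin_num => //; exact: integrable_horner.
Qed.

(** If the integral of [f ^+ 2 * w] were 0, then [f ^+ 2 * w] would vanish almost everywhere;
but it only vanishes at the finitely many roots of [f]. *)
Lemma represents_posdef w L : positive_weight w -> represents w L -> posdef L.
Proof.
move=> [wi w0] Lw f f0.
have wE x : u < x < v -> 0 <= (f * f).[x] * w x.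
  by move=> /w0/ltW w0x; rewrite hornerM mulr_ge0// -expr2 sqr_ge0.
have oc : `]u, v[%classic `<=` `[u, v] := @subset_itv_oo_cc _ _ u v.
have mff : measurable_fun `]u, v[ (fun x => ((f * f).[x] * w x)%:E).
  have /measurable_int := integrable_horner (f * f) wi.
  by apply: measurable_funS => //; exact: measurable_itv.
have LE : (\int[mu]_(x in `]u, v[) `|((f * f).[x] * w x)%:E| = (L (f * f))%:E)%E.
  rewrite -Lw [RHS]integral_itv_bndoo; last exact: mff.
  by apply: eq_integral => x; rewrite inE/= in_itv/= => /wE xf; rewrite ger0_norm.
have Lge0 : 0 <= L (f * f) by rewrite -lee_fin -LE integral_ge0.
rewrite lt_neqAle Lge0 andbT; apply/negP => /eqP L0.
have [+ _] := ae_eq_integral_abs mu (measurable_itv _) mff.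
rewrite LE -L0 => /(_ erefl) neg.
have [s fs] := poly_finite_roots f0.
case: (itv_not_negligible uv).
apply: negligibleS (negligibleU neg (seq_negligible s)) => x xuv.
have [/fs|fx] := boolP (root f x); [by right|left => /= /(_ xuv) [/eqP]].
rewrite hornerM !mulf_eq0 -!/(root f x) (negPf fx)/=.
by rewrite gt_eqF// w0//; move: xuv; rewrite /= in_itv.
Qed.

Lemma orthopolyP w L : positive_weight w -> represents w L ->
  orthonormal L (orthopoly u v w).
Proof.
move=> pw Lw; suff [gp lp op] : orthonormal_polys u v w (orthopoly u v w).
  split=> // m n; have := op m n.
  by under eq_integral do rewrite -hornerM; rewrite Lw => -[].
rewrite /orthopoly; apply: xgetPex.
have [p [gp lp op]] := orthonormal_exists (represents_posdef pw Lw).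
exists p; split=> // m n.
by under eq_integral do rewrite -hornerM; rewrite Lw op.
Qed.

Lemma integrable_oo_cc w : measurable_fun `[u, v] w ->
  mu.-integrable `]u, v[ (EFin \o w) -> mu.-integrable `[u, v] (EFin \o w).
Proof.
move=> mw /integrableP[mow iw]; apply/integrableP; split; first exact/measurable_EFinP.
by rewrite integral_itv_bndoo//; exact: measurableT_comp.
Qed.

(** Two weights are compared on the open interval only: at the ends a power with a negative
exponent is not given by the formula that holds inside. *)
Lemma integrable_mul_bounded w w' (h : R -> R) M :
  measurable_fun [set: R] w' -> mu.-integrable `[u, v] (EFin \o w) ->
  (forall x, u < x < v -> w' x = h x * w x) ->
  (forall x, u < x < v -> `|h x| <= M) -> mu.-integrable `[u, v] (EFin \o w').
Proof.
move=> mw' iw w'E hM; apply: integrable_oo_cc; first exact: measurable_funTS.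
have iw' : mu.-integrable `]u, v[ (EFin \o (fun x => M * w x)).
  rewrite (_ : EFin \o _ = (fun x => M%:E * (EFin \o w) x)%E)//.
  apply: integrableZl => //; apply: integrableS iw => //.
  exact: subset_itv_oo_cc.
apply: le_integrable iw' => //; first exact/measurable_EFinP/measurable_funTS.
move=> x; rewrite /= in_itv/= => xuv; rewrite lee_fin w'E// !normrM.
by rewrite ler_wpM2r// (le_trans (hM _ xuv))// ler_norm.
Qed.

Lemma represents_mul w w' L L' g : represents w L -> represents w' L' ->
  mu.-integrable `[u, v] (EFin \o w) -> mu.-integrable `[u, v] (EFin \o w') ->
  (forall x, u < x < v -> w' x = g.[x] * w x) -> forall f, L' f = L (g * f).
Proof.
move=> Lw Lw' iw iw' w'E f; apply: EFin_inj; rewrite -Lw -Lw'.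
have mo w1 f1 : mu.-integrable `[u, v] (EFin \o w1) ->
    measurable_fun `]u, v[ (fun x => (f1.[x] * w1 x)%:E).
  move=> /(integrable_horner f1)/measurable_int; apply: measurable_funS => //.
  exact: subset_itv_oo_cc.
rewrite [LHS]integral_itv_bndoo; last exact: mo.
rewrite [RHS]integral_itv_bndoo; last exact: mo.
apply: eq_integral => x; rewrite inE/= in_itv/= => xuv; congr _%:E.
by rewrite w'E// hornerM mulrA [f.[x] * _]mulrC.
Qed.

(** This is how integration by parts is used: applied to a primitive of the form
[w1 * f], where the derivative of [w1] is a polynomial multiple of [w]. *)
Lemma represents_derive0 w L F G : represents w L ->
  mu.-integrable `[u, v] (EFin \o w) ->
  (forall x, u < x < v -> {for x, continuous w}) ->
  (forall x, u < x < v -> is_derive x 1 F (G.[x] * w x)) ->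
  F x @[x --> u^'+] --> 0 -> F x @[x --> v^'-] --> 0 -> L G = 0.
Proof.
move=> Lw iw cw dF Fu Fv; apply: EFin_inj; rewrite -Lw.
have iG : mu.-integrable `]u, v[ (EFin \o (fun x => G.[x] * w x)).
  by apply: integrableS (integrable_horner G iw) => //; exact: subset_itv_oo_cc.
rewrite integral_itv_bndoo; last exact: measurable_int iG.
apply: (@integral_derive0 _ _ _ uv F _) => // x xuv.
by apply: continuousM; [exact: continuous_horner|exact: cw].
Qed.

End Weights.

(** * Powers and Jacobi weights *)

Section Powers.
Context {R : realType}.

Lemma powR_cvg0_squeeze (b K : R) (z g : nat -> R) : 0 < b ->
  (forall n, 0 < z n) -> z n @[n --> \oo] --> 0 ->
  (\forall n \near \oo, `|g n| <= K * z n `^ b) -> g n @[n --> \oo] --> 0.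
Proof.
move=> b0 z0 zcvg gK.
have zb : z n `^ b @[n --> \oo] --> 0.
  by apply: (cvg_at_rightP (fun x => x `^ b) 0 0).1 => //; exact: powR_cvg0.
have Kzb : K * z n `^ b @[n --> \oo] --> 0.
  by rewrite -[X in _ --> X](mulr0 K); apply: cvgM => //; exact: cvg_cst.
apply: (squeeze_cvgr _ _ Kzb); last first.
  by rewrite -[X in _ --> X]oppr0; apply: cvgN; exact: Kzb.
by apply: filterS gK => n; rewrite ler_norml.
Qed.

Variables (u v : R).
Hypothesis uv : u < v.

(** The boundary terms of all the integrations by parts vanish, since the exponents of
the weight that is differentiated are positive. *)
Lemma jacobi_cvg0 (a b M : R) (phi : R -> R) : 0 < a -> 0 < b ->
  (forall x, u < x < v -> `|phi x| <= M) ->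
  (v - x) `^ a * (x - u) `^ b * phi x @[x --> u^'+] --> 0 /\
  (v - x) `^ a * (x - u) `^ b * phi x @[x --> v^'-] --> 0.
Proof.
move=> a0 b0 phiM.
have bd (r y : R) : 0 < r -> 0 < y < v - u -> y `^ r <= (v - u) `^ r.
  move=> r0 /andP[y0 yl]; apply: ge0_ler_powR; rewrite ?nnegrE ?ltW//.
  exact: lt_trans yl.
split.
- apply/cvg_at_rightP => z [zu zcvg].
  apply: (@powR_cvg0_squeeze b ((v - u) `^ a * M) (fun n => z n - u)) => //.
  + by move=> n; rewrite subr_gt0.
  + by rewrite -(subrr u); apply: cvgB => //; exact: cvg_cst.
  near=> n; have znv : z n < v by near: n; exact: (cvgr_lt u).
  rewrite !normrM !(ger0_norm (powR_ge0 _ _)) mulrAC ler_wpM2r ?powR_ge0//.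
  apply: ler_pM; rewrite ?powR_ge0 ?normr_ge0//; last by apply: phiM; rewrite zu.
  by apply: bd => //; rewrite subr_gt0 znv ltrD2l ltrN2 zu.
- apply/cvg_at_leftP => z [zv zcvg].
  apply: (@powR_cvg0_squeeze a ((v - u) `^ b * M) (fun n => v - z n)) => //.
  + by move=> n; rewrite subr_gt0.
  + by rewrite -(subrr v); apply: cvgB => //; exact: cvg_cst.
  near=> n; have znu : u < z n by near: n; exact: (cvgr_gt v).
  rewrite !normrM !(ger0_norm (powR_ge0 _ _)) -mulrA mulrC ler_wpM2r ?powR_ge0//.
  apply: ler_pM; rewrite ?powR_ge0 ?normr_ge0//; last by apply: phiM; rewrite zv znu.
  by apply: bd => //; rewrite subr_gt0 znu ltrD2r zv.
Unshelve. all: by end_near. Qed.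

Lemma is_derive_powR_comp (g : R -> R) (a x dg : R) : 0 < g x ->
  is_derive x 1 g dg -> is_derive x 1 (fun y => g y `^ a) (a * g x `^ (a - 1) * dg).
Proof. by move=> gx dgx; apply: (is_derive1_comp (is_derive1_powR a gx) dgx). Qed.

Lemma is_derive_horner_comp (p : {poly R}) (g : R -> R) (x dg : R) :
  is_derive x 1 g dg -> is_derive x 1 (fun y => p.[g y]) (p^`().[g x] * dg).
Proof. by move=> dgx; apply: (is_derive1_comp (is_derive_poly p (g x)) dgx). Qed.

Lemma measurable_powR_comp (g : R -> R) a : measurable_fun [set: R] g ->
  measurable_fun [set: R] (fun x => g x `^ a).
Proof. by move=> mg; apply: (measurableT_comp (measurable_powR a)). Qed.

Lemma powR_split (x a : R) : 0 < x -> x `^ a = x `^ (a - 1) * x.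
Proof. by move=> x0; rewrite -[X in _ * X]powRr1 ?ltW// -powRD ?subrK// (gt_eqF x0) implybT. Qed.

(** Write [l = v - u], so that [l = (v - x) + (x - u)].  Then [l] times the weight is at most
[l `^ a * (x - u) `^ (b - 1) + l `^ b * (v - x) `^ (a - 1)], which has a bounded
primitive. *)
Lemma jacobi_weight_positive (a b : R) : 0 < a -> 0 < b ->
  positive_weight u v (fun x => (v - x) `^ (a - 1) * (x - u) `^ (b - 1)).
Proof.
move=> a0 b0; split; last first.
  by move=> x /andP[ux xv]; rewrite mulr_gt0// powR_gt0// subr_gt0.
pose A := (v - u) `^ a; pose B := (v - u) `^ b.
have A0 : 0 <= A := powR_ge0 _ _.
have B0 : 0 <= B := powR_ge0 _ _.
pose F x := A / b * (x - u) `^ b - B / a * (v - x) `^ a.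
pose f x := A * (x - u) `^ (b - 1) + B * (v - x) `^ (a - 1).
have mup c : measurable_fun [set: R] (fun x => (x - u) `^ c).
  by apply: measurable_powR_comp; exact: measurable_funB.
have mvp c : measurable_fun [set: R] (fun x => (v - x) `^ c).
  by apply: measurable_powR_comp; exact: measurable_funB.
have bd (r y : R) : 0 < r -> 0 <= y <= v - u -> y `^ r <= (v - u) `^ r.
  move=> r0 /andP[y0 yl]; apply: ge0_ler_powR; rewrite ?nnegrE ?(ltW r0)//.
  exact: le_trans yl.
have du (c x : R) : u < x -> is_derive x 1 (fun y => (y - u) `^ c) (c * (x - u) `^ (c - 1)).
  move=> ux; rewrite -[c * _]mulr1.
  apply: (@is_derive_powR_comp (fun y => y - u)); first by rewrite subr_gt0.
  by apply: is_derive_eq; rewrite subr0.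
have dv (c x : R) : x < v -> is_derive x 1 (fun y => (v - y) `^ c) (- (c * (v - x) `^ (c - 1))).
  move=> xv; rewrite -[- (c * _)]mulrN1.
  apply: (@is_derive_powR_comp (fun y => v - y)); first by rewrite subr_gt0.
  by apply: is_derive_eq; ring.
have cpow (g : R -> R) (x dg : R) : is_derive x 1 g dg -> {for x, continuous g}.
  by case=> /derivable1_diffP + _; exact: differentiable_continuous.
have fi : (@lebesgue_measure R).-integrable `]u, v[ (EFin \o f).
  apply: (@derive_ge0_integrable _ _ _ uv F f _ _ (A / b * B + B / a * A)).
  - move=> x /andP[ux xv]; have := du b _ ux; have := dv a _ xv => *.
    rewrite /F /f; apply: is_derive_eq.
    by rewrite /GRing.scale/=; field; rewrite !gt_eqF.
  - move=> x /andP[ux xv]; rewrite /f.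
    apply: cvgD; apply: cvgM; (try exact: cvg_cst).
    + exact: (cpow _ _ _ (du _ _ ux)).
    + exact: (cpow _ _ _ (dv _ _ xv)).
  - by move=> x _; rewrite addr_ge0// mulr_ge0// powR_ge0.
  - move=> x /andP[ux xv]; rewrite (le_trans (ler_normB _ _))//.
    rewrite !normrM !normfV !(gtr0_norm a0) !(gtr0_norm b0) !ger0_norm ?powR_ge0//.
    by apply: lerD; rewrite ler_wpM2l ?divr_ge0 ?(ltW a0) ?(ltW b0)//; apply: bd => //;
      apply/andP; split; lra.
have mw : measurable_fun [set: R] (fun x => (v - x) `^ (a - 1) * (x - u) `^ (b - 1)).
  exact: measurable_funM.
apply: integrable_oo_cc => //; first exact: measurable_funTS mw.
have fi' : (@lebesgue_measure R).-integrable `]u, v[ (EFin \o (fun x => (v - u)^-1 * f x)).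
  rewrite (_ : EFin \o _ = (fun x => (v - u)^-1%:E * (EFin \o f) x)%E)//.
  by apply: integrableZl.
apply: le_integrable fi' => //.
  by apply/measurable_EFinP; exact: measurable_funTS mw.
move=> x; rewrite /= in_itv/= lee_fin => /andP[ux xv].
have vu0 : 0 < v - u by rewrite subr_gt0.
rewrite !ger0_norm; last 2 first.
- by rewrite mulr_ge0 ?invr_ge0 ?(ltW vu0)// addr_ge0 ?mulr_ge0 ?powR_ge0.
- by rewrite mulr_ge0 ?powR_ge0.
rewrite [X in _ <= X]mulrC ler_pdivlMr// /f.
have vxa : (v - x) `^ (a - 1) * (v - x) <= A.
  by rewrite -powR_split ?subr_gt0//; apply: bd => //; apply/andP; split; lra.
have xub : (x - u) `^ (b - 1) * (x - u) <= B.
  by rewrite -powR_split ?subr_gt0//; apply: bd => //; apply/andP; split; lra.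
have p0 : 0 <= (v - x) `^ (a - 1) := powR_ge0 _ _.
have q0 : 0 <= (x - u) `^ (b - 1) := powR_ge0 _ _.
by nra.
Qed.

End Powers.

(** * The factor in z: Jacobi polynomials *)

Section Parity.
Context {R : realType}.
Implicit Types (L : {scalar {poly R}}) (p q : nat -> {poly R}) (f g : {poly R}).

(** The polynomial [q n] is orthogonal to all polynomials of lower degree, so it is a multiple
of [p n]; the multiple is a square root of 1, and it is positive. *)
Lemma orthonormal_unique L p q n : orthonormal L p -> orthonormal L q -> p n = q n.
Proof.
move=> op oq; have [gp lp Lp] := op; have [gq lq Lq] := oq.
have qp : q n = L (q n * p n) *: p n.
  have sq : (size (q n) <= n.+1)%N by rewrite gq.
  rewrite [LHS](orthonormal_expand op sq) big_ord_recr/= big1 ?add0r// => i _.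
  by rewrite mulrC (orthonormal_low oq) ?gp// scale0r.
move: qp; set l := L (q n * p n) => qp.
have l0 : 0 < l by have := lq n; rewrite qp lead_coefZ pmulr_lgt0.
have l2 : l ^+ 2 = 1.
  have := Lq n n; rewrite eqxx {1}qp -scalerAl linearZ/=.
  by rewrite expr2 [p n * _]mulrC -/l.
have l1 : l = 1 by apply/eqP; rewrite -(@pexpr_eq1 _ _ 2) ?ltW// l2.
by rewrite qp l1 scale1r.
Qed.

Definition flip f := f \Po (- 'X).

Lemma flipM f g : flip (f * g) = flip f * flip g.
Proof. exact: comp_polyM. Qed.

(** In terms of a weight: the weight is an even function. *)
Definition even_functional L := forall f, L (flip f) = L f.

Lemma even_functional_moments L : (forall n, odd n -> L 'X^n = 0) ->
  even_functional L.
Proof.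
move=> L0 f; rewrite /flip comp_polyE -[in RHS](coefK f) poly_def !linear_sum.
apply: eq_bigr => i _; rewrite !linearZ/= exprNn -signr_odd.
case: (boolP (odd i)) => oi; last by rewrite expr0 mul1r.
by rewrite expr1 mulN1r linearN/= L0// oppr0.
Qed.

Lemma even_functional_odd L f : even_functional L -> flip f = - f -> L f = 0.
Proof.
move=> eL rf; have := eL f; rewrite rf linearN/= => /eqP.
by rewrite eq_sym -addr_eq0 -mulr2n mulrn_eq0/= => /eqP.
Qed.

(** The flipped polynomials, with the signs that make the leading coefficients positive, are
orthonormal again. *)
Lemma orthonormal_parity L p n : even_functional L -> orthonormal L p ->
  flip (p n) = (-1) ^+ n *: p n.
Proof.
move=> eL op; have [gp lp Lp] := op.
have sX : size (- 'X : {poly R}) = 2%N by rewrite size_polyN size_polyX.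
have lX : lead_coef (- 'X : {poly R}) = -1 by rewrite lead_coefN lead_coefX.
have sg (m : nat) : (-1 : R) ^+ m * (-1) ^+ m = 1.
  by rewrite -exprMn mulN1r opprK expr1n.
have oq : orthonormal L (fun m => (-1) ^+ m *: flip (p m)).
  split=> [m|m|i j].
  - by rewrite size_scale ?signr_eq0// /flip size_comp_poly2.
  - by rewrite lead_coefZ /flip lead_coef_comp ?sX// lX gp/= mulrCA sg mulr1.
  - rewrite -scalerAl -scalerAr scalerA -flipM linearZ/= eL Lp.
    by case: eqP => [->|_]; rewrite ?mulr0// mulr1 sg.
by rewrite [in RHS](orthonormal_unique n op oq) scalerA sg scale1r.
Qed.

End Parity.

Lemma size_deriv_leq (R : nzRingType) (f : {poly R}) : (size f^`() <= (size f).-1)%N.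
Proof. exact: size_poly. Qed.

Section Jacobi.
Context {R : realType}.
Variables (u v c d : R) (M M1 : {scalar {poly R}}) (P' P : nat -> {poly R}).

Let kappa : {poly R} := (v%:P - 'X) * ('X - u%:P).
(* If [w] is the weight of [M], then the derivative of [w * kappa * f] is
   [w * (q * f + kappa * f^`())]. *)
Let q : {poly R} := c *: (v%:P - 'X) - d *: ('X - u%:P).

Hypothesis M1E : forall f, M1 f = M (kappa * f).
Hypothesis by_parts : forall f : {poly R}, M (q * f + kappa * f^`()) = 0.
Hypotheses (oP' : orthonormal M P') (oP : orthonormal M1 P).

Variable k : nat.
Let r := coord P (P' k) k.
Let t := - coord P (P' k.+1) k.
Let s := - coord P (P' k.+2) k.
Let gm := coord P ('X * P k) k.
Let dl := coord P ('X * P k) k.+1.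
Let dk j := coord P (P' j.+1)^`() j.
(* The derivative of [w * kappa * P k] is [w * U]. *)
Let U := q * P k + kappa * (P k)^`().

Let gP' : graded P'. Proof. by case: oP'. Qed.
Let gP : graded P. Proof. by case: oP. Qed.

Lemma jacobi_kappaE : kappa = - 'X^2 + (v + u) *: 'X - (v * u)%:P.
Proof. by rewrite /kappa polyCM -mul_polyC polyCD; ring. Qed.

Lemma jacobi_qE : q = - (c + d) *: 'X + (c * v + d * u)%:P.
Proof. by rewrite /q -!mul_polyC !(polyCD, polyCM, polyCN); ring. Qed.

(** Orthogonality from below and a bound on the degree leave three coordinates. *)
Lemma three_terms (f : {poly R}) : (size f <= k.+3)%N ->
  (forall i, (i < k)%N -> M (f * P' i) = 0) ->
  f = M (f * P' k) *: P' k + M (f * P' k.+1) *: P' k.+1 + M (f * P' k.+2) *: P' k.+2.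
Proof.
move=> sf f0; rewrite {1}(orthonormal_expand oP' sf) !big_ord_recr/= big1 ?add0r// => i _.
by rewrite f0// scale0r.
Qed.

Lemma size_kappaM (f : {poly R}) n : (size f <= n)%N -> (size (kappa * f)%R <= n.+2)%N.
Proof.
move=> sf; rewrite (leq_trans (size_polyMleq _ _))//.
have : (size kappa <= 3)%N.
  rewrite /kappa (leq_trans (size_polyMleq _ _))// size_XsubC.
  by rewrite -opprB size_polyN size_XsubC.
move: sf; lia.
Qed.

Lemma size_qM (f : {poly R}) n : (size f <= n)%N -> (size (q * f)%R <= n.+1)%N.
Proof.
move=> sf; rewrite (leq_trans (size_polyMleq _ _))//.
have : (size q <= 2)%N.
  rewrite /q (leq_trans (size_polyD _ _))// geq_max size_polyN.
  rewrite !(leq_trans (size_scale_leq _ _)) ?size_XsubC//.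
  by rewrite -opprB size_polyN size_XsubC.
move: sf; lia.
Qed.

Lemma size_U j : (size (q * P j + kappa * (P j)^`())%R <= j.+2)%N.
Proof.
rewrite (leq_trans (size_polyD _ _))// geq_max size_qM ?gP//=.
by rewrite size_kappaM// (leq_trans (size_deriv_leq _))// gP.
Qed.

Lemma coef_kappaM (f : {poly R}) n :
  (kappa * f)`_n.+2 = - f`_n + (v + u) * f`_n.+1 - v * u * f`_n.+2.
Proof.
rewrite jacobi_kappaE mulrBl mulrDl mulNr coefB coefD coefN coefXnM/= subn2/=.
by rewrite -scalerAl coefZ coefXM/= coefCM.
Qed.

Lemma coef_qM (f : {poly R}) n :
  (q * f)`_n.+1 = - (c + d) * f`_n + (c * v + d * u) * f`_n.+1.
Proof. by rewrite jacobi_qE mulrDl coefD -scalerAl coefZ coefXM/= coefCM. Qed.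

Lemma coef_kappaP : (kappa * P k)`_k.+2 = - (P k)`_k.
Proof.
by rewrite coef_kappaM ![_`_ _.+1]nth_default ?gP// !mulr0 addr0 subr0.
Qed.

Lemma coef_XU : ('X * U)`_k.+2 = - (c + d + k%:R) * (P k)`_k.
Proof.
rewrite coefXM/= /U coefD coef_qM [(P k)`_k.+1]nth_default ?gP// mulr0 addr0.
case: k gP => [|j] gPj.
  have -> : (P 0%N)^`() = 0.
    by apply/eqP; rewrite -size_poly_eq0 -leqn0 (leq_trans (size_deriv_leq _))// gPj.
  by rewrite mulr0 coef0 !addr0.
rewrite coef_kappaM !coef_deriv ![(P j.+1)`_ _.+2]nth_default ?gPj//.
rewrite !mul0rn !mulr0 addr0 subr0.
by rewrite -mulr_natl; ring.
Qed.

(** The coordinate at [P' i] is the pairing of [P k] and [P' i] under [M1], that is, the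
coordinate of [P' i] at [P k].  So the constants of the expansion of [P' i] in the
polynomials [P] reappear, transposed. *)
Lemma kappaP_expand : kappa * P k = r *: P' k - t *: P' k.+1 - s *: P' k.+2.
Proof.
have E i : M (kappa * P k * P' i) = coord P (P' i) k.
  by rewrite (coord_orthonormal _ _ oP) M1E mulrA mulrAC.
rewrite {1}(three_terms (size_kappaM (eq_leq (gP k)))) ?E /t /s ?scaleNr ?opprK// => i ik.
by rewrite E coord_oversize// gP'.
Qed.

(** Since [M (q * f + kappa * f^`()) = 0], the derivative that is hidden in [U] moves
to ['X * P' i]. *)
Lemma M_XU i : M ('X * U * P' i) = - coord P (P' i) k - coord P ('X * (P' i)^`()) k.
Proof.
rewrite !(coord_orthonormal _ _ oP) !M1E -!linearN -linearD/=.
apply/eqP; rewrite -subr_eq0 -linearB -(by_parts (P k * ('X * P' i)))/=.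
apply/eqP; congr (M _); rewrite /U !derivM derivX; ring.
Qed.

(** The derivative of [P' i.+1] is orthogonal under [M1] to all polynomials of degree less
than [i], again by parts. *)
Lemma deriv_P' i : (P' i.+1)^`() = dk i *: P i.
Proof.
have sd : (size (P' i.+1)^`() <= i.+1)%N by rewrite (leq_trans (size_deriv_leq _))// gP'.
rewrite {1}(coord_sum gP sd) big_ord_recr/= big1 ?add0r// => j _.
have -> : coord P (P' i.+1)^`() j = - M ((q * P j + kappa * (P j)^`()) * P' i.+1).
  apply/eqP; rewrite (coord_orthonormal _ _ oP) M1E -addr_eq0 -linearD/=.
  rewrite -(by_parts (P j * P' i.+1))/=.
  by apply/eqP; congr (M _); rewrite !derivM; ring.
by rewrite (orthonormal_low oP') ?oppr0 ?scale0r// (leq_trans (size_U j)) ?ltnS.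
Qed.

(** Since ['X * (P' k)^`() - k *: P' k] has degree less than [k]. *)
Lemma coord_XdP' : coord P ('X * (P' k)^`()) k = k%:R * r.
Proof.
apply/eqP; rewrite -subr_eq0 /r -mulNr -coordZ// -coordD// scaleNr.
rewrite coord_oversize//; apply/leq_sizeP => j; rewrite leq_eqVlt.
rewrite coefB coefZ coefXM => /predU1P[<-|kj].
  by case: k => [|n]/=; rewrite ?mul0r ?subrr// coef_deriv mulr_natl subrr.
rewrite [(P' k)`_j]nth_default ?gP'// mulr0 subr0 nth_default ?if_same//.
rewrite (leq_trans (size_deriv_leq _))// gP'; move: kj; case: j => //.
Qed.

Lemma XU_low i : (i < k)%N -> M ('X * U * P' i) = 0.
Proof.
move=> ik; rewrite M_XU !coord_oversize ?subr0 ?oppr0// ?gP'//.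
have sd := size_deriv_leq (P' i); rewrite gP'/= in sd.
by rewrite (leq_trans (size_polyMleq _ _))// size_polyX/= (leq_ltn_trans sd).
Qed.

Lemma coord_P'Sk : coord P (P' k.+1) k = - t.
Proof. by rewrite opprK. Qed.

(** Compare ['X * U] with [kappa * P k], which has the same degree [k + 2]: the leading
coefficients differ by the factor [c + d + k]. *)
Lemma M_XU_top : M ('X * U * P' k.+2) = - ((c + d + k%:R) * s).
Proof.
have sXU : (size ('X * U)%R <= k.+3)%N.
  by rewrite (leq_trans (size_polyMleq _ _))// size_polyX/= ltnS size_U.
rewrite (orthonormal_top oP' sXU (size_kappaM (eq_leq (gP k))) (l := c + d + k%:R)).
  by rewrite -mulrN /s opprK (coord_orthonormal _ _ oP) M1E mulrA mulrAC.
by rewrite coef_XU coef_kappaP mulNr mulrN.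
Qed.

Lemma XU_expand : 'X * U =
  - (k.+1%:R * r) *: P' k + (t - gm * dk k) *: P' k.+1 - ((c + d + k%:R) * s) *: P' k.+2.
Proof.
have sXU : (size ('X * U)%R <= k.+3)%N.
  by rewrite (leq_trans (size_polyMleq _ _))// size_polyX/= ltnS size_U.
rewrite {1}(three_terms sXU XU_low) M_XU_top !M_XU coord_XdP' deriv_P'.
rewrite -scalerAr coordZ// coord_P'Sk opprK scaleNr; congr (_ *: _ + _ *: _ - _).
  by rewrite -/r -natr1; ring.
by rewrite -/gm mulrC.
Qed.

(** The pairing of ['X * U] with [P' k.+2] is computed in two ways: by parts ([M_XU]) and from the
leading coefficient ([M_XU_top]). *)
Lemma delta_d : dl * dk k.+1 = (c + d + k%:R + 1) * s.
Proof.
have := M_XU_top; rewrite M_XU deriv_P' -scalerAr coordZ//.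
have -> : coord P ('X * P k.+1) k = dl.
  by rewrite /dl !(coord_orthonormal _ _ oP) mulrAC.
rewrite -/s => E; have -> : dl * dk k.+1 = s - (s - dk k.+1 * dl) by ring.
by rewrite E; ring.
Qed.

Section Symmetric.
Hypotheses (uE : u = - v) (dE : d = c) (c0 : 0 < c).

(** Integration by parts gives a recursion that expresses the moment of order [j + 2] by the
moment of order [j]; the moment of order 1 is 0. *)
Lemma even_M : even_functional M.
Proof.
have kE : kappa = - 'X^2 + (v ^+ 2)%:P.
  by rewrite jacobi_kappaE uE subrr scale0r addr0 mulrN polyCN opprK expr2.
have qX : q = - (2 * c) *: 'X.
  by rewrite jacobi_qE uE dE mulrN subrr addr0; congr (- _ *: _); ring.
apply: even_functional_moments => n on; rewrite -(odd_double_half n) on add1n.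
elim: n./2 => [|j IHj].
  have := by_parts 1; rewrite derivC mulr0 addr0 mulr1 qX linearZ/= => /eqP.
  by rewrite mulf_eq0 oppr_eq0 mulf_eq0 pnatr_eq0/= (gt_eqF c0) expr1 => /eqP.
pose m := j.+1.*2; have := by_parts ('X^m); rewrite derivXn qX kE.
have -> : - (2 * c) *: 'X * 'X^m + (- 'X^2 + (v ^+ 2)%:P) * ('X^(m.-1) *+ m) =
    - (2 * c + m%:R) *: 'X^(m.+1) + (v ^+ 2 * m%:R) *: 'X^(j.*2.+1) :> {poly R}.
  rewrite -[_ *+ m]mulr_natr -polyC_natr; move: (m%:R) => N; rewrite /m doubleS/=.
  by rewrite -!mul_polyC !polyCN !polyCD !polyCM !exprS; ring.
rewrite linearD !linearZ/= IHj mulr0 addr0 => /eqP.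
rewrite mulf_eq0 oppr_eq0 gt_eqF/= => [/eqP//|].
by rewrite ltr_wpDr// mulr_gt0.
Qed.

Lemma even_M1 : even_functional M1.
Proof.
move=> f; rewrite !M1E -[RHS]even_M flipM; congr (M (_ * _)).
rewrite /flip /kappa comp_polyM !comp_polyB !comp_polyC comp_polyX uE polyCN; ring.
Qed.

Lemma t_sym : t = 0.
Proof.
rewrite /t (coord_orthonormal _ _ oP) (even_functional_odd even_M1) ?oppr0//.
rewrite flipM (orthonormal_parity _ even_M oP') (orthonormal_parity _ even_M1 oP).
rewrite -scalerAl -scalerAr scalerA exprS -mulrA -expr2 sqrr_sign mulr1.
by rewrite scaleN1r.
Qed.

Lemma gamma_sym : gm = 0.
Proof.
rewrite /gm (coord_orthonormal _ _ oP) (even_functional_odd even_M1)//.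
rewrite !flipM (orthonormal_parity _ even_M1 oP) {1}/flip comp_polyX.
rewrite -!scalerAr -scalerAl scalerA -expr2 sqrr_sign scale1r.
by rewrite !mulNr.
Qed.

End Symmetric.

End Jacobi.

(** * The factor in x: expansions in the polynomials R *)

(** A sum over [i] is turned into a sum over [m = i + h], of which the terms below [lo] are 0. *)
Lemma sum_shift (R : realType) (F : nat -> R) (N h lo : nat) :
  (forall i, (i + h < lo)%N -> F i = 0) ->
  \sum_(i < N) F i = \sum_(lo <= m < N + h | (h <= m)%N) F (m - h)%N.
Proof.
move=> F0; transitivity (\sum_(h <= m < N + h) F (m - h)%N).
  rewrite -{1}[h]add0n big_addn addnK big_mkord.
  by apply: eq_bigr => i _; rewrite addnK.
rewrite (big_nat_widenl _ 0%N)// [RHS](big_nat_widenl _ 0%N)//.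
rewrite big_mkcond [RHS]big_mkcond/=; apply: eq_bigr => m _.
case: (leqP h m) => //= hm; case: ltnP => // mlo.
by rewrite F0// subnK.
Qed.

Section Sizes.
Context {R : realType}.
Implicit Types (f g S T : {poly R}) (q r : nat -> {poly R}).

Lemma size_mul_leq f g m n l : (size f <= m)%N -> (size g <= n)%N ->
  (m + n <= l.+1)%N -> (size (f * g)%R <= l)%N.
Proof.
by move=> fm gn mnl; rewrite (leq_trans (size_polyMleq _ _))//; lia.
Qed.

Lemma size_half_deriv S T D : S^`() = T + T -> (size S <= D.+1)%N ->
  (size T <= D)%N.
Proof.
move=> ST sS; have -> : T = 2^-1 *: S^`().
  by rewrite ST -mulr2n -[T *+ 2]scaler_nat scalerA mulVf ?pnatr_eq0// scale1r.
rewrite (leq_trans (size_scale_leq _ _))// (leq_trans (size_deriv_leq _))//.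
by case: (size S) sS.
Qed.

Lemma coord_mul_deriv_low q r f e i j : graded q -> graded r ->
  (size f <= e.+1)%N -> (i + e <= j)%N -> coord q (f * (r i)^`()) j = 0.
Proof.
move=> gq gr sf ij; rewrite coord_oversize//.
have := size_deriv_leq (r i); rewrite gr => /= sd.
by apply: (size_mul_leq sf sd); lia.
Qed.

Lemma coord_mul_low q r f e i j : graded q -> graded r ->
  (size f <= e)%N -> (i + e <= j)%N -> coord q (f * r i) j = 0.
Proof.
move=> gq gr sf ij; rewrite coord_oversize//.
by apply: (size_mul_leq sf (eq_leq (gr i))); lia.
Qed.

End Sizes.

Section Rside.
Context {R : realType}.
Variables (u v a b sg : R) (S T : {poly R}).
Variables (L L1 : {scalar {poly R}}) (R1 : nat -> {poly R}).

Let kappa : {poly R} := (v%:P - 'X) * ('X - u%:P).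
Let kab : {poly R} := b *: (v%:P - 'X) - a *: ('X - u%:P).
(* Here [S] stands for [rho ^+ 2] and [T] for [rho * rho'].  If [w] is the weight of [L], then
   [w * S * kappa] is the weight of [L1], and its derivative is [w * Q]. *)
Let Q : {poly R} := S * kab + sg *: (T * kappa).

Hypothesis ST : S^`() = T + T.
Hypothesis L1E : forall f, L1 f = L (S * kappa * f).
Hypothesis by_parts : forall f : {poly R}, L (Q * f + S * kappa * f^`()) = 0.
Hypothesis oR1 : orthonormal L1 R1.

Variable j : nat.
Let V := kab * R1 j + kappa * (R1 j)^`().
Let G0 := S * V + sg *: (T * kappa * R1 j).

Let gR1 : graded R1. Proof. by case: oR1. Qed.

Let s_kappa : (size kappa <= 3)%N.
Proof.
apply: (@size_mul_leq _ _ _ 2 2) => //; last by rewrite size_XsubC.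
by rewrite -opprB size_polyN size_XsubC.
Qed.

Let s_kab : (size kab <= 2)%N.
Proof.
rewrite (leq_trans (size_polyD _ _))// geq_max size_polyN.
rewrite !(leq_trans (size_scale_leq _ _)) ?size_XsubC//.
by rewrite -opprB size_polyN size_XsubC.
Qed.

Let s_dR1 : (size (R1 j)^`() <= j)%N.
Proof. by rewrite (leq_trans (size_deriv_leq _))// gR1. Qed.

Let s_V : (size V <= j.+2)%N.
Proof.
rewrite (leq_trans (size_polyD _ _))// geq_max.
rewrite (size_mul_leq s_kab (eq_leq (gR1 j)))//=.
by rewrite (size_mul_leq s_kappa s_dR1)//; lia.
Qed.

Let G0_parts f : L (G0 * f) = - L1 (R1 j * f^`()).
Proof.
apply/eqP; rewrite L1E -addr_eq0 -linearD/=; apply/eqP.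
rewrite -(by_parts (R1 j * f)); congr (L _).
by rewrite /G0 /V /Q derivM -!mul_polyC; ring.
Qed.

(** [G0] is, up to the weight, the derivative of the weight of [R1] times [R1 j].  Its pairing with
[f] is minus the pairing of [R1 j] with the derivative of [f]. *)
Lemma expand_k (R0 : nat -> {poly R}) D : orthonormal L R0 ->
  (size S <= D.+1)%N ->
  G0 = \sum_(i < (j + D).+2) - coord R1 (R0 i)^`() j *: R0 i.
Proof.
move=> oR0 sS; have sT := size_half_deriv ST sS.
have sG : (size G0 <= (j + D).+2)%N.
  rewrite (leq_trans (size_polyD _ _))// geq_max (size_mul_leq sS s_V) ?andTb; last by lia.
  rewrite (leq_trans (size_scale_leq _ _))//.
  have sTk : (size (T * kappa)%R <= D.+2)%N by apply: (size_mul_leq sT s_kappa); lia.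
  by apply: (size_mul_leq sTk (eq_leq (gR1 j))); lia.
rewrite {1}(orthonormal_expand oR0 sG); apply: eq_bigr => i _; congr (_ *: _).
by rewrite G0_parts (coord_orthonormal _ _ oR1) mulrC.
Qed.

(** The target weight is [S ^+ 2] times that of [L], and [S * V] is [G0] up to a multiple of
[T * kappa * R1 j]; so the coordinates of [V] reduce to those of [G0].  The factor
[sg + 2] collects this multiple and the derivative [T + T] of [S]. *)
Lemma expand_k2 (L2 : {scalar {poly R}}) (R2 : nat -> {poly R}) :
  (forall f, L2 f = L (S ^+ 2 * f)) -> orthonormal L2 R2 ->
  V = \sum_(i < j.+2)
    - (coord R1 (S * (R2 i)^`()) j + (sg + 2) * coord R1 (T * R2 i) j) *: R2 i.
Proof.
move=> L2E oR2; rewrite {1}(orthonormal_expand oR2 s_V).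
apply: eq_bigr => i _; congr (_ *: _); rewrite L2E.
have -> : S ^+ 2 * (V * R2 i) = G0 * (S * R2 i) - sg *: (S * kappa * (T * R2 i * R1 j)).
  by rewrite /G0 -!mul_polyC; ring.
rewrite linearB linearZ/= G0_parts -L1E !(coord_orthonormal _ _ oR1).
have -> : R1 j * (S * R2 i)^`() =
    S * (R2 i)^`() * R1 j + T * R2 i * R1 j *+ 2.
  by rewrite derivM ST; ring.
by rewrite linearD linearMn/= mulr2n; ring.
Qed.

Section Polynomial_rho.
Variables (p : {poly R}) (e : nat) (t mu : R).
Hypotheses (Sp : S = p ^+ 2) (Tp : T = p * p^`()) (sp : (size p <= e.+1)%N).
Let G1 := - t *: (p * V) + mu *: (kappa * p^`() * R1 j).

Let sdp : (size p^`() <= e)%N.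
Proof. by rewrite (leq_trans (size_deriv_leq _))//; case: (size p) sp. Qed.

(** As for [expand_k2], with [S = p ^+ 2] and a target weight that is [S] times that of [L]. *)
Lemma expand_k1 (L3 : {scalar {poly R}}) (R3 : nat -> {poly R}) :
  (forall f, L3 f = L (S * f)) -> orthonormal L3 R3 ->
  G1 = \sum_(i < (j + e).+2)
    (t * coord R1 (p * (R3 i)^`()) j +
     ((1 + sg) * t + mu) * coord R1 (p^`() * R3 i) j) *: R3 i.
Proof.
move=> L3E oR3; have sG : (size G1 <= (j + e).+2)%N.
  rewrite (leq_trans (size_polyD _ _))// geq_max.
  rewrite !(leq_trans (size_scale_leq _ _))//.
    have skp : (size (kappa * p^`())%R <= e.+2)%N by apply: (size_mul_leq s_kappa sdp); lia.
    by apply: (size_mul_leq skp (eq_leq (gR1 j))); lia.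
  by apply: (size_mul_leq sp s_V); lia.
rewrite {1}(orthonormal_expand oR3 sG); apply: eq_bigr => i _; congr (_ *: _); rewrite L3E.
have -> : S * (G1 * R3 i) = - t *: (G0 * (p * R3 i)) +
   (t * sg + mu) *: (S * kappa * (p^`() * R3 i * R1 j)).
  rewrite /G1 /G0 Tp Sp -!mul_polyC !polyCD !polyCM !polyCN; ring.
rewrite linearD !linearZ/= G0_parts -L1E !(coord_orthonormal _ _ oR1).
have -> : R1 j * (p * R3 i)^`() = p * (R3 i)^`() * R1 j + p^`() * R3 i * R1 j.
  by rewrite derivM; ring.
by rewrite linearD/=; ring.
Qed.

End Polynomial_rho.

End Rside.

(** * The function rho, and the functionals of the Jacobi weights *)

Lemma is_derive_continuous (R : realType) (g : R -> R) (x dg : R) :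
  is_derive x 1 g dg -> {for x, continuous g}.
Proof. by case=> /derivable1_diffP + _; exact: differentiable_continuous. Qed.

(** Both derivatives of powers are written with the exponents lowered by one, so that the result has
the lowered weight as a factor also when [phi] is the rest of a product. *)
Lemma is_derive_jacobi (R : realType) (u v a b x dphi : R) (phi : R -> R) :
  u < x < v -> is_derive x 1 phi dphi ->
  is_derive x 1 (fun y => (v - y) `^ a * (y - u) `^ b * phi y)
    ((v - x) `^ (a - 1) * (x - u) `^ (b - 1) *
     ((b * (v - x) - a * (x - u)) * phi x + (v - x) * (x - u) * dphi)).
Proof.
move=> /andP[ux xv] dp.
have vx0 : 0 < v - x by rewrite subr_gt0.
have xu0 : 0 < x - u by rewrite subr_gt0.
have dv : is_derive x 1 (fun y => v - y) (-1) by apply: is_derive_eq; ring.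
have du : is_derive x 1 (fun y => y - u) 1 by apply: is_derive_eq; ring.
have dvp := @is_derive_powR_comp R (fun y => v - y) a x _ vx0 dv.
have dup := @is_derive_powR_comp R (fun y => y - u) b x _ xu0 du.
apply: is_derive_eq; rewrite /GRing.scale/= (powR_split a vx0) (powR_split b xu0).
by ring.
Qed.

Section Rho.
Context {R : realType} (D : domain R).

Lemma rho_inside x : alpha D < x < beta D -> 0 < rho D x.
Proof. exact: rho_gt0. Qed.

Lemma rho_sqE x : alpha D < x < beta D -> (rho_sq D).[x] = rho D x ^+ 2.
Proof.
move=> /rho_inside; rewrite /rho_sq /rho /rho_of; case: (eta D).
  by rewrite sqrtr_gt0 => /ltW p0; rewrite sqr_sqrtr.
by rewrite horner_exp.
Qed.

Lemma rho_derive x : alpha D < x < beta D ->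
  is_derive x 1 (rho D) ((rho_rho' D).[x] / rho D x).
Proof.
move=> /rho_inside; rewrite /rho_rho' /rho /rho_of; case: (eta D) => r0.
  have p0 : 0 < (rpoly D).[x] by rewrite sqrtr_gt0 in r0.
  have dr := is_derive1_comp (is_derive1_sqrt p0) (is_derive_poly (rpoly D) x).
  apply: (is_derive_eq dr); rewrite hornerZ; field.
  by rewrite gt_eqF.
apply: (is_derive_eq (is_derive_poly (rpoly D) x)).
by rewrite hornerM mulrAC divff ?gt_eqF// mul1r.
Qed.

Lemma deriv_rho_sq : (rho_sq D)^`() = rho_rho' D + rho_rho' D.
Proof.
rewrite /rho_sq /rho_rho'; case: (eta D).
  by rewrite -scalerDl (_ : 2^-1 + 2^-1 = 1) ?scale1r//; field.
by rewrite expr2 derivM mulrC.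
Qed.

Lemma measurable_rho : measurable_fun [set: R] (rho D).
Proof.
rewrite /rho /rho_of; case: (eta D); last exact: measurable_horner.
have ms : measurable_fun [set: R] (@Num.sqrt R).
  by apply: continuous_measurable_fun; exact: sqrt_continuous.
exact: (measurableT_comp ms (measurable_horner (rpoly D))).
Qed.

Lemma rho_powR_bounded s : 0 <= s ->
  exists M, forall x, alpha D < x < beta D -> rho D x `^ s <= M.
Proof.
move=> s0; have [M M0 pM] := horner_bounded (alpha D) (beta D) (rho_sq D).
exists ((M + 1) `^ s) => x xab; have r0 := rho_inside xab.
apply: ge0_ler_powR => //; rewrite ?nnegrE; [exact: ltW|by rewrite addr_ge0 ?ltW|].
have := pM x; rewrite rho_sqE// ger0_norm ?sqr_ge0//.
by case/andP: xab => /ltW -> /ltW -> /(_ isT); nra.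
Qed.

End Rho.

Section Pside.
Context {R : realType} (D : domain R) (c d : R).
Hypotheses (c_gt0 : 0 < c) (d_gt0 : 0 < d).
Let kappa : {poly R} := ((del D)%:P - 'X) * ('X - (gam D)%:P).
Let q : {poly R} := c *: ((del D)%:P - 'X) - d *: ('X - (gam D)%:P).

(** The functionals of the weights of parameters [(d - 1, c - 1)] and [(d, c)].  The second is
the first one precomposed with multiplication by [kappa]; integration by parts
relates the first to itself. *)
Lemma Pside_functionals : exists M M1 : {scalar {poly R}},
  [/\ forall f : {poly R}, M1 f = M (kappa * f),
      forall f : {poly R}, M (q * f + kappa * f^`()) = 0,
      orthonormal M (Ppol D (d - 1) (c - 1)) & orthonormal M1 (Ppol D d c)].
Proof.
have uv := lt_gam_del D.
have pw' := jacobi_weight_positive uv d_gt0 c_gt0.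
(* These are the parameters [(d + 1 - 1, c + 1 - 1)]. *)
have pw : positive_weight (gam D) (del D) (wP D d c).
  have := jacobi_weight_positive uv (addr_gt0 d_gt0 ltr01) (addr_gt0 c_gt0 ltr01).
  by rewrite !addrK.
have [M MM] := functional_exists pw'.1.
have [M1 MM1] := functional_exists pw.1.
exists M, M1; split.
- apply: (represents_mul MM MM1 pw'.1 pw.1) => x /andP[ux xv].
  rewrite /wP (powR_split d) ?subr_gt0// (powR_split c) ?subr_gt0// !hornerE/=; ring.
- move=> f.
  have [K K0 fK] := horner_bounded (gam D) (del D) f.
  have fK' x : gam D < x < del D -> `|f.[x]| <= K.
    by move=> /andP[ux xv]; apply: fK; rewrite !ltW.
  have [F0 F1] := jacobi_cvg0 uv d_gt0 c_gt0 fK'.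
  apply: (represents_derive0 uv MM pw'.1 _ _ F0 F1) => x xuv.
  + have := is_derive_jacobi (d - 1) (c - 1) xuv (is_derive_poly 1 x).
    rewrite (_ : (fun y => _ * _ * _) = (fun y => (del D - y) `^ (d - 1) * (y - gam D) `^ (c - 1))).
      exact: is_derive_continuous.
    by apply/funext => y; rewrite hornerC mulr1.
  + have := is_derive_jacobi d c xuv (is_derive_poly f x).
    move=> df; apply: (is_derive_eq df); rewrite !hornerE/=; ring.
- exact: orthopolyP.
- exact: orthopolyP.
Qed.

End Pside.

(** * The weights in x, and the coefficients as coordinates *)

Section Rconcrete.
Context {R : realType} (D : domain R) (a b c d : R).
Hypotheses (a_gt0 : 0 < a) (b_gt0 : 0 < b) (c_gt0 : 0 < c) (d_gt0 : 0 < d).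
Hypothesis wR_integrable : (@lebesgue_measure R).-integrable `[alpha D, beta D]
     (EFin \o wR D (a - 1, b - 1, c + d - 1)).

(** The parameters at which the weight is dominated by the one that is assumed to be
integrable. *)
Definition admissible (p : param R) :=
  [/\ a - 1 <= p.1.1, b - 1 <= p.1.2 & c + d - 1 <= p.2].

Lemma measurable_wR p : measurable_fun [set: R] (wR D p).
Proof.
case: p => [[a' b'] s']; rewrite /wR; apply: measurable_funM; first apply: measurable_funM.
- by apply: measurable_powR_comp; exact: measurable_funB.
- by apply: measurable_powR_comp; exact: measurable_funB.
- by apply: measurable_powR_comp; exact: measurable_rho.
Qed.

Lemma wR_positive p : admissible p -> positive_weight (alpha D) (beta D) (wR D p).
Proof.
case: p => [[a' b'] s'] [/= aa' bb' ss']; split; last first.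
  move=> x xab; have r0 := rho_inside xab; case/andP: xab => ax xb.
  by rewrite /wR !mulr_gt0// powR_gt0 ?subr_gt0.
have s0 : 0 <= s' - (c + d - 1) by rewrite subr_ge0.
have [M rM] := rho_powR_bounded D s0.
pose h x := (beta D - x) `^ (a' - (a - 1)) * (x - alpha D) `^ (b' - (b - 1)) *
  rho D x `^ (s' - (c + d - 1)).
pose l := beta D - alpha D.
apply: (@integrable_mul_bounded _ _ _ _ _ h
    (l `^ (a' - (a - 1)) * l `^ (b' - (b - 1)) * M)) wR_integrable _ _.
- exact: measurable_wR.
- move=> x xab; have r0 := rho_inside xab; case/andP: xab => ax xb.
  rewrite /wR /h; have pE (y e e' : R) : 0 < y -> y `^ e = y `^ (e - e') * y `^ e'.
    by move=> y0; rewrite -powRD ?subrK// (gt_eqF y0) implybT.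
  rewrite (pE _ a' (a - 1)) ?subr_gt0// (pE _ b' (b - 1)) ?subr_gt0//.
  rewrite (pE _ s' (c + d - 1))//; ring.
- move=> x xab; have rx := rM x xab; case/andP: xab => ax xb.
  rewrite ger0_norm ?mulr_ge0 ?powR_ge0//.
  have bd (e y : R) : 0 <= e -> 0 < y <= l -> y `^ e <= l `^ e.
    move=> e0 /andP[y0 yl]; apply: ge0_ler_powR => //; rewrite ?nnegrE ?(ltW y0)//.
    exact: le_trans (ltW y0) yl.
  apply: ler_pM => //; rewrite ?mulr_ge0 ?powR_ge0//; apply: ler_pM; rewrite ?powR_ge0//.
  + by apply: bd; rewrite ?subr_ge0// subr_gt0 xb lerD2l lerN2 ltW.
  + by apply: bd; rewrite ?subr_ge0// subr_gt0 ax lerD2r ltW.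
Qed.

Lemma Rpol_orthonormal p : admissible p ->
  exists2 L, represents (alpha D) (beta D) (wR D p) L & orthonormal L (Rpol D p).
Proof.
move=> /wR_positive pw; have [L ML] := functional_exists pw.1.
by exists L => //; apply: orthopolyP => //; exact: lt_alpha_beta.
Qed.

Lemma Rpol_graded p : admissible p -> graded (Rpol D p).
Proof. by move=> /Rpol_orthonormal[L _ []]. Qed.

Lemma raisingE p q : raising D p q = opmx (Rpol D q) (Rpol D p) id.
Proof. by []. Qed.

(** Differentiation leads from the parameters [(a - 1, b - 1, s)] to [(a, b, s')]; the equation
on [s'] allows the form in which the target is needed. *)
Lemma diffmxE s s' : s + 1 + (eta D)%:R = s' ->
  diffmx D (a - 1, b - 1, s) =
  opmx (Rpol D (a, b, s')) (Rpol D (a - 1, b - 1, s)) (fun f => f^`()).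
Proof. by move=> <-; rewrite /diffmx !subrK. Qed.

Section Coefficients.
Variable k : nat.
Let s0 : R := c + d + 2 * k%:R.
Let R1 := Rpol D (a, b, s0 + 1).

Let le_ab : (a - 1 <= a) * (b - 1 <= b). Proof. by split; lra. Qed.

Let adm1 s : -1 <= s -> admissible (a, b, s0 + s).
Proof.
by move=> s1; split=> /=; rewrite ?le_ab// /s0; have := ler0n R k; lra.
Qed.

Let adm0 s : -1 <= s -> admissible (a - 1, b - 1, s0 + s).
Proof.
by move=> s1; split=> //=; rewrite /s0; have := ler0n R k; lra.
Qed.

Let eta01 : (0 <= (eta D)%:R :> R) /\ ((eta D)%:R <= 1 :> R).
Proof. by case: (eta D); rewrite ?lexx ?ler01. Qed.

Let gR1 : graded R1. Proof. by apply: Rpol_graded; apply: adm1; lra. Qed.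

(** The raising matrix changes the basis in which the derivative is expressed, so its source
parameter [s0 + eta] drops out. *)
Lemma cbar_kE n m : cbar_k D a b c d n k m =
  - (rJ D d c k * coord R1 (Rpol D (a - 1, b - 1, s0 - 1) (m - k)%N)^`() (n - k)%N).
Proof.
have [e0 e1] := eta01.
have gRe : graded (Rpol D (a, b, s0 + (eta D)%:R)) by apply: Rpol_graded; apply: adm1; lra.
rewrite /cbar_k -/s0 (@diffmxE _ (s0 + (eta D)%:R)); last by ring.
by rewrite raisingE (imul_opmx _ _ gR1 gRe linear_idp) mulNr.
Qed.

(** The inverse raising matrices first rewrite the target polynomials in the basis from which
the differentiation or raising matrix starts; these intermediate bases drop out. *)
Lemma cbar_k2E n m : let R2 := Rpol D (a - 1, b - 1, s0 + 3) in
  cbar_k2 D a b c d n k m =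
  sJ D d c k * coord R1 (rho_sq D * (R2 (m - k - 2)%N)^`()) (n - k)%N +
  ((k + 2)%:R * sJ D d c k + deltaJ D d c k * dJ D d c k.+1) *
  coord R1 (rho_rho' D * R2 (m - k - 2)%N) (n - k)%N.
Proof.
have [e0 e1] := eta01; move=> R2.
have gR2 : graded R2 by apply: Rpol_graded; apply: adm0; lra.
have gRm : graded (Rpol D (a - 1, b - 1, s0 - (eta D)%:R)).
  by apply: Rpol_graded; apply: adm0; lra.
have gR3 : graded (Rpol D (a - 1, b - 1, s0 + 1)).
  by apply: Rpol_graded; apply: adm0; lra.
rewrite /cbar_k2 -/s0 (@diffmxE _ (s0 + 1)); last by ring.
exact: (congr2 (fun A B : imatrix R => sJ D d c k * A (n - k)%N (m - k - 2)%N +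
    ((k + 2)%:R * sJ D d c k + deltaJ D d c k * dJ D d c k.+1) *
    B (n - k)%N (m - k - 2)%N)
  (imul_mul_deriv_raise (rho_sq D) gR1 gRm gR2)
  (imul_mul_raise2 (rho_rho' D) gR1 gR3 gR2)).
Qed.

Lemma cbar_k1E n m : let R3 := Rpol D (a - 1, b - 1, s0 + 1) in eta D = false ->
  cbar_k1 D a b c d n k m =
  tJ D d c k * coord R1 (rpoly D * (R3 (m - k - 1)%N)^`()) (n - k)%N +
  ((k + 1)%:R * tJ D d c k + gammaJ D d c k * dJ D d c k) *
  coord R1 ((rpoly D)^`() * R3 (m - k - 1)%N) (n - k)%N.
Proof.
move=> R3 eF; have gR3 : graded R3 by apply: Rpol_graded; apply: adm0; lra.
have gRm : graded (Rpol D (a - 1, b - 1, s0)).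
  by rewrite -[s0]addr0; apply: Rpol_graded; apply: adm0; lra.
rewrite /cbar_k1 -/s0 (@diffmxE _ (s0 + 1)); last by rewrite eF addr0.
exact: (congr2 (fun A B : imatrix R => tJ D d c k * A (n - k)%N (m - k - 1)%N +
    ((k + 1)%:R * tJ D d c k + gammaJ D d c k * dJ D d c k) *
    B (n - k)%N (m - k - 1)%N)
  (imul_mul_deriv_raise (rpoly D) gR1 gRm gR3)
  (imul_mul_raise _ (rpoly D)^`() gR1)).
Qed.

Let kappa : {poly R} := ((beta D)%:P - 'X) * ('X - (alpha D)%:P).
Let kab : {poly R} := b *: ((beta D)%:P - 'X) - a *: ('X - (alpha D)%:P).
Let Q : {poly R} := rho_sq D * kab + (s0 + 1) *: (rho_rho' D * kappa).

(** The four weights that occur for a given [k].  All are expressed by the one of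
parameters [(a - 1, b - 1, s0 - 1)], from which the others differ by even powers of [rho] and
by [kappa], and so by polynomials in both cases. *)
Lemma Rside_functionals : exists L L1 L2 L3 : {scalar {poly R}},
  [/\ forall f, L1 f = L (rho_sq D * kappa * f),
      forall f : {poly R}, L (Q * f + rho_sq D * kappa * f^`()) = 0,
      orthonormal L1 R1 /\ orthonormal L (Rpol D (a - 1, b - 1, s0 - 1)),
      (forall f, L2 f = L (rho_sq D ^+ 2 * f)) /\
      orthonormal L2 (Rpol D (a - 1, b - 1, s0 + 3)) &
      (forall f, L3 f = L (rho_sq D * f)) /\
      orthonormal L3 (Rpol D (a - 1, b - 1, s0 + 1))].
Proof.
have adm11 : admissible (a, b, s0 + 1) by apply: adm1; lra.
have adm00 : admissible (a - 1, b - 1, s0 - 1) by apply: adm0; lra.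
have adm02 : admissible (a - 1, b - 1, s0 + 3) by apply: adm0; lra.
have adm03 : admissible (a - 1, b - 1, s0 + 1) by apply: adm0; lra.
have [L ML oL] := Rpol_orthonormal adm00.
have [L1 ML1 oL1] := Rpol_orthonormal adm11.
have [L2 ML2 oL2] := Rpol_orthonormal adm02.
have [L3 ML3 oL3] := Rpol_orthonormal adm03.
have iw p (ap : admissible p) := (wR_positive ap).1.
have rho2 x (e : R) : alpha D < x < beta D ->
    rho D x `^ (e + 2) = (rho_sq D).[x] * rho D x `^ e.
  move=> xab; have r0 := rho_inside xab; rewrite rho_sqE// mulrC.
  by rewrite powRD ?(gt_eqF r0) ?implybT// -[2]/(2%:R) powR_mulrn ?ltW.
exists L, L1, L2, L3; split.
- apply: (represents_mul ML ML1 (iw _ adm00) (iw _ adm11)) => x xab.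
  rewrite /wR (_ : s0 + 1 = s0 - 1 + 2); last by ring.
  rewrite rho2//; case/andP: xab => ax xb.
  rewrite (powR_split a) ?subr_gt0// (powR_split b) ?subr_gt0//.
  by rewrite /kappa !hornerM hornerXsubC !hornerE/=; ring.
- move=> f; have uv := lt_alpha_beta D.
  have s1 : 0 <= s0 + 1.
    by rewrite /s0; have := ler0n R k; have := c_gt0; have := d_gt0; lra.
  have [K K0 fK] := horner_bounded (alpha D) (beta D) f.
  have [M rM] := rho_powR_bounded D s1.
  pose phi x := rho D x `^ (s0 + 1) * f.[x].
  have phiM x : alpha D < x < beta D -> `|phi x| <= M * K.
    move=> xab; rewrite normrM ger0_norm ?powR_ge0//; apply: ler_pM; rewrite ?powR_ge0//.
      exact: rM.
    by case/andP: xab => ax xb; apply: fK; rewrite !ltW.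
  have [F0 F1] := jacobi_cvg0 uv a_gt0 b_gt0 phiM.
  apply: (represents_derive0 uv ML (iw _ adm00) _ _ F0 F1) => x xab.
  + have dr := rho_derive xab; have r0 := rho_inside xab.
    have := is_derive_jacobi (a - 1) (b - 1) xab (is_derive_powR_comp (s0 - 1) r0 dr).
    exact: is_derive_continuous.
  + have dr := rho_derive xab; have r0 := rho_inside xab.
    have drp := is_derive_powR_comp (s0 + 1) r0 dr.
    have dphi : is_derive x 1 phi _ := is_deriveM drp (is_derive_poly f x).
    apply: (is_derive_eq (is_derive_jacobi a b xab dphi)).
    rewrite /wR /phi /GRing.scale/= (_ : s0 + 1 - 1 = s0 - 1 + 1); last by ring.
    rewrite (powR_split (s0 - 1 + 1) r0) addrK (_ : s0 + 1 = s0 - 1 + 2); last by ring.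
    rewrite rho2// /Q /kab /kappa !hornerE/=; field.
    by rewrite gt_eqF.
- by split; [exact: oL1|exact: oL].
- split; last exact: oL2.
  apply: (represents_mul ML ML2 (iw _ adm00) (iw _ adm02)) => x xab.
  rewrite /wR (_ : s0 + 3 = s0 - 1 + 2 + 2); last by ring.
  by rewrite !rho2// horner_exp; ring.
- split; last exact: oL3.
  apply: (represents_mul ML ML3 (iw _ adm00) (iw _ adm03)) => x xab.
  rewrite /wR (_ : s0 + 1 = s0 - 1 + 2); last by ring.
  by rewrite rho2//; ring.
Qed.

End Coefficients.

End Rconcrete.

(** * The derivative of the weighted polynomials *)

Section Derivative.
Context {R : realType} (D : domain R) (a b c d : R).
Let kappa : {poly R} := ((beta D)%:P - 'X) * ('X - (alpha D)%:P).
Let kab : {poly R} := b *: ((beta D)%:P - 'X) - a *: ('X - (alpha D)%:P).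
Let kappaP : {poly R} := ((del D)%:P - 'X) * ('X - (gam D)%:P).
Let qP : {poly R} := c *: ((del D)%:P - 'X) - d *: ('X - (gam D)%:P).

(** In [W] the factors that depend on [y] are [rho x * (z - gam)] and [rho x * (del - z)].
Their derivatives and those of [rho x ^+ k] and [P.[z]] combine to
[(c + d + k) * kappaP * P - 'X * (qP * P + kappaP * P^`())] at [z]. *)
Lemma weighted_derive (Q P : {poly R}) (k : nat) (x y : R) : inside D x y ->
  let z := y / rho D x in
  is_derive x (1 : R)
    (fun x' => W D a b c d x' y * (Q.[x'] * rho D x' ^+ k * P.[y / rho D x']))
    (W D (a - 1) (b - 1) (c - 1) (d - 1) x y * rho D x ^+ k *
     ((rho_sq D * (kab * Q + kappa * Q^`())).[x] * (kappaP * P).[z] +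
      (rho_rho' D * kappa * Q).[x] *
        ((c + d + k%:R) * (kappaP * P).[z] -
         ('X * (qP * P + kappaP * P^`())).[z]))).
Proof.
move=> [xab /andP[gy yd]] z.
have r0 := rho_inside xab; have dr := rho_derive xab.
set T := (rho_rho' D).[x] in dr.
have C0 : 0 < y - gam D * rho D x by rewrite subr_gt0.
have E0 : 0 < del D * rho D x - y by rewrite subr_gt0.
have dC : is_derive x 1 (fun x' => y - gam D * rho D x') (- gam D * (T / rho D x)).
  by apply: is_derive_eq; rewrite /GRing.scale/=; ring.
have dE : is_derive x 1 (fun x' => del D * rho D x' - y) (del D * (T / rho D x)).
  by apply: is_derive_eq; rewrite /GRing.scale/=; ring.
have dCp := @is_derive_powR_comp R (fun x' => y - gam D * rho D x') c x _ C0 dC.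
have dEp := @is_derive_powR_comp R (fun x' => del D * rho D x' - y) d x _ E0 dE.
have dz : is_derive x 1 (fun x' => y / rho D x') (- (z * T / rho D x ^+ 2)).
  have dV := is_deriveV (lt0r_neq0 r0) dr.
  apply: (is_derive_eq (is_deriveM (is_derive_cst y x 1) dV)).
  by rewrite /z /GRing.scale/=; field; rewrite gt_eqF.
have dP := is_derive_horner_comp P dz.
have dX : is_derive x 1 (fun x' => rho D x' ^+ k)
    (k%:R * rho D x ^+ k / rho D x * (T / rho D x)).
  have := is_deriveX k dr; rewrite (_ : rho D ^+ k = fun x' => rho D x' ^+ k); last first.
    by apply/funext => x'; rewrite exprfctE.
  move=> drk; apply: (is_derive_eq drk); rewrite /GRing.scale/=.
  case: (k) => [|k']/=; first by rewrite !mul0r.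
  by rewrite exprS; field; rewrite gt_eqF.
have dphi : is_derive x 1 (fun x' => (y - gam D * rho D x') `^ c *
  (del D * rho D x' - y) `^ d * (Q.[x'] * rho D x' ^+ k * P.[y / rho D x'])) _ :=
  is_deriveM (is_deriveM dCp dEp)
    (is_deriveM (is_deriveM (is_derive_poly Q x) dX) dP).
rewrite (_ : (fun x' => _) = (fun x' => (beta D - x') `^ a * (x' - alpha D) `^ b *
  ((y - gam D * rho D x') `^ c * (del D * rho D x' - y) `^ d *
   (Q.[x'] * rho D x' ^+ k * P.[y / rho D x'])))); last first.
  by apply/funext => x'; rewrite /W; ring.
apply: (is_derive_eq (is_derive_jacobi a b xab dphi)).
rewrite /W /GRing.scale !mulrfctE/= (powR_split c C0) (powR_split d E0).
have yz : y = z * rho D x by rewrite /z divfK ?gt_eqF.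
rewrite !hornerM !(hornerD, hornerN, hornerZ, hornerX, hornerC, hornerM) -/z rho_sqE// -/T.
move: ((y - gam D * rho D x) `^ (c - 1)) ((del D * rho D x - y) `^ (d - 1)) => Cp Ep.
move: (P^`().[z]) (P.[z]) (Q.[x]) (Q^`().[x]) => P'z Pz Qx Q'x.
move: (rho D x ^+ k) (k%:R) => rk kr.
move: ((beta D - x) `^ (a - 1)) ((x - alpha D) `^ (b - 1)) => Bp Ap.
rewrite yz; move: (rho D x) (lt0r_neq0 r0) (z) (T) => r rn0 z' T'.
by field.
Qed.

End Derivative.

Section Expansion.
Context {R : realType} (D : domain R) (a b c d : R).
Hypotheses (a_gt0 : 0 < a) (b_gt0 : 0 < b) (c_gt0 : 0 < c) (d_gt0 : 0 < d).
Hypothesis eq_cd : eta D -> c = d.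
Hypothesis wR_integrable : (@lebesgue_measure R).-integrable `[alpha D, beta D]
     (EFin \o wR D (a - 1, b - 1, c + d - 1)).

Lemma H_targetE m l s x y : c - 1 + (d - 1) + 2 * l%:R + 1 = s ->
  H D (a - 1) (b - 1) (c - 1) (d - 1) m l x y =
  (Rpol D (a - 1, b - 1, s) (m - l)%N).[x] * rho D x ^+ l *
  (Ppol D (d - 1) (c - 1) l).[y / rho D x].
Proof. by move=> <-. Qed.

(** One family of terms: the factor [w * rh * r * A] comes from the weight and from the polynomial
in [z], and [G] is the polynomial in [x]; the index [i] of its expansion becomes
[m = i + h]. *)
Lemma weighted_sum_shift (C : nat -> R) (G : {poly R}) (q : nat -> {poly R})
    (N h lo hi : nat) (w rh A r x : R) :
  G = \sum_(i < N) C i *: q i -> (forall i, (i + h < lo)%N -> C i = 0) ->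
  (N + h)%N = hi ->
  w * rh * r * A * G.[x] =
  \sum_(lo <= m < hi | (h <= m)%N) (r * C (m - h)%N) * w * ((q (m - h)%N).[x] * rh * A).
Proof.
move=> -> C0 <-; rewrite horner_sum mulr_sumr.
rewrite (@sum_shift _ (fun i => w * rh * r * A * (C i *: q i).[x]) N h lo); last first.
  by move=> i /C0 ->; rewrite scale0r horner0 mulr0.
by apply: eq_bigr => m _; rewrite hornerZ; ring.
Qed.

Lemma size_rho_sq : (size (rho_sq D) <= (deg_rho_sq D).+1)%N.
Proof. exact: leqSpred. Qed.

Section Column.
Variables (n k : nat) (x y : R).
Hypotheses (kn : (k <= n)%N) (xy : inside D x y).

Let W' := W D (a - 1) (b - 1) (c - 1) (d - 1) x y.
Let H' m j := H D (a - 1) (b - 1) (c - 1) (d - 1) m j x y.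
Let z := y / rho D x.
Let s0 : R := c + d + 2 * k%:R.

(** The polynomials in [z] are expanded in [P' k], [P' k.+1], [P' k.+2]; what multiplies each of them is
then expanded in [x]. *)
Lemma derive_column :
  is_derive x (1 : R) (fun x' => W D a b c d x' y * H D a b c d n k x' y)
    (\sum_(n + 1 <= m < (n + deg_rho_sq D + 1).+1)
          cbar_k D a b c d n k m * W' * H' m k
     + \sum_(n + 3 - deg_rho_sq D <= m < (n + 3).+1 | (k + 2 <= m)%N)
         cbar_k2 D a b c d n k m * W' * H' m (k + 2)%N
     + (if eta D then 0 else
        \sum_(n + 2 - d0 D <= m < (n + d0 D + 2).+1 | (k + 1 <= m)%N)
          cbar_k1 D a b c d n k m * W' * H' m (k + 1)%N)).
Proof.
have [M [M1 [M1E byP oP' oP]]] := Pside_functionals D c_gt0 d_gt0.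
have [L [L1 [L2 [L3 [L1E byR [oR1 oR0] [L2E oR2] [L3E oR3]]]]]] :=
  Rside_functionals a_gt0 b_gt0 c_gt0 d_gt0 wR_integrable k.
have [xab _] := xy; have r0 := rho_inside xab.
have gR1 : graded _ := let: And3 g _ _ := oR1 in g.
have gR0 : graded _ := let: And3 g _ _ := oR0 in g.
have gR2 : graded _ := let: And3 g _ _ := oR2 in g.
have gR3 : graded _ := let: And3 g _ _ := oR3 in g.
have EA := congr1 (fun f : {poly R} => f.[z]) (kappaP_expand M1E oP' oP k).
have EB := congr1 (fun f : {poly R} => f.[z]) (XU_expand M1E byP oP' oP k).
have ED := delta_d M1E byP oP' oP k.
have dF := weighted_derive a b c d (Rpol D (a, b, s0 + 1) (n - k)%N) (Ppol D d c k) k xy.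
apply: (is_derive_eq dF) => {dF}; rewrite -/W' -/z.
pose S := rho_sq D; pose T := rho_rho' D.
pose kappa : {poly R} := ((beta D)%:P - 'X) * ('X - (alpha D)%:P).
pose kab : {poly R} := b *: ((beta D)%:P - 'X) - a *: ('X - (alpha D)%:P).
pose R1 := Rpol D (a, b, s0 + 1).
pose V := kab * R1 (n - k)%N + kappa * (R1 (n - k)%N)^`().
pose G0 := S * V + (s0 + 1) *: (T * kappa * R1 (n - k)%N).
pose t := tJ D d c k; pose g := gammaJ D d c k * dJ D d c k.
pose rh := rho D x.
pose A i := (Ppol D (d - 1) (c - 1) i).[z].
have {}EA : (((del D)%:P - 'X) * ('X - (gam D)%:P) * Ppol D d c k).[z] =
    rJ D d c k * A k - t * A k.+1 - sJ D d c k * A k.+2.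
  by rewrite [LHS]EA !(hornerD, hornerN, hornerZ).
have {}EB : ('X * ((c *: ((del D)%:P - 'X) - d *: ('X - (gam D)%:P)) * Ppol D d c k +
        ((del D)%:P - 'X) * ('X - (gam D)%:P) * (Ppol D d c k)^`())).[z] =
    - (k.+1%:R * rJ D d c k) * A k + (t - g) * A k.+1 - (c + d + k%:R) * sJ D d c k * A k.+2.
  by rewrite [LHS]EB !(hornerD, hornerN, hornerZ).
have SE : S.[x] = rh ^+ 2 by exact: rho_sqE.
(* In the coefficient of [A k.+2] the terms with [T] cancel, because that of [P' k.+2] in
   ['X * U] is [- (c + d + k) s_k]. *)
transitivity (W' * rh ^+ k * rJ D d c k * A k * G0.[x] +
  W' * rh ^+ (k + 2)%N * 1 * A (k + 2)%N * (- sJ D d c k *: V).[x] +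
  W' * rh ^+ k * A (k + 1)%N * (- t * (rh ^+ 2 * V.[x]) +
     (g - t * (c + d + k%:R + 1)) * (T * kappa * R1 (n - k)%N).[x])).
  rewrite EA EB -/S -/T -/kappa -/kab -/R1 -/V /G0 hornerZ hornerD hornerZ hornerM SE.
  rewrite exprD !addn1 !addn2 -/rh /s0 -[k.+1%:R]natr1.
  move: (A k) (A k.+1) (A k.+2) (V.[x]) ((T * kappa * R1 (n - k)%N).[x]) => A0 A1 A2 Vx Tx.
  move: (rJ D d c k) (sJ D d c k) (k%:R : R) => r s kr; ring.
congr (_ + _ + _).
- pose R0 := Rpol D (a - 1, b - 1, s0 - 1).
  pose C i := - coord R1 (R0 i)^`() (n - k)%N.
  have EG : G0 = \sum_(i < (n - k + deg_rho_sq D).+2) C i *: R0 i.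
    exact: (expand_k (deriv_rho_sq D) L1E byR oR1 (n - k)%N oR0 size_rho_sq).
  have C0 i : (i + k < n + 1)%N -> C i = 0.
    move=> ik; rewrite /C -[(R0 i)^`()]mul1r.
    rewrite (@coord_mul_deriv_low _ _ _ 1 0 _ _ gR1 gR0) ?oppr0 ?size_poly1//.
    by clear -kn ik; lia.
  rewrite (@weighted_sum_shift C G0 R0 _ k (n + 1) (n + deg_rho_sq D + 1).+1
    W' (rh ^+ k) (A k) (rJ D d c k) x EG C0); last by clear -kn; lia.
  rewrite [LHS]big_nat_cond [RHS]big_nat_cond; apply: eq_big => m.
    by clear -kn; lia.
  move=> _; rewrite (cbar_kE wR_integrable) /H'.
  have -> : H D (a - 1) (b - 1) (c - 1) (d - 1) m k x y = (R0 (m - k)%N).[x] * rh ^+ k * A k.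
    apply: H_targetE; rewrite /s0; ring.
  by rewrite /C mulrN.
- have EV := expand_k2 (deriv_rho_sq D) L1E byR oR1 (n - k)%N L2E oR2.
  pose C i := sJ D d c k * coord R1 (rho_sq D * (Rpol D (a - 1, b - 1, s0 + 3) i)^`()) (n - k)%N +
    ((k + 2)%:R * sJ D d c k + deltaJ D d c k * dJ D d c k.+1) *
    coord R1 (rho_rho' D * Rpol D (a - 1, b - 1, s0 + 3) i) (n - k)%N.
  pose R2 := Rpol D (a - 1, b - 1, s0 + 3).
  have EG : - sJ D d c k *: V = \sum_(i < (n - k).+2) C i *: R2 i.
    rewrite /V [X in _ *: X]EV scaler_sumr; apply: eq_bigr => i _; rewrite scalerA; congr (_ *: _).
    have E : deltaJ D d c k * dJ D d c k.+1 = (c + d + k%:R + 1) * sJ D d c k by exact: ED.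
    rewrite /C E natrD /s0.
    move: (sJ D d c k) (coord _ _ _) (coord _ _ _) => s c1 c2; ring.
  have C0 i : (i + (k + 2) < n + 3 - deg_rho_sq D)%N -> C i = 0.
    move=> ik; rewrite /C.
    rewrite (coord_mul_deriv_low gR1 gR2 size_rho_sq); last by clear -kn ik; lia.
    rewrite (coord_mul_low gR1 gR2 (size_half_deriv (deriv_rho_sq D) size_rho_sq)).
      by rewrite !mulr0 addr0.
    by clear -kn ik; lia.
  rewrite (@weighted_sum_shift C _ R2 _ (k + 2) (n + 3 - deg_rho_sq D) (n + 3).+1
    W' (rh ^+ (k + 2)) (A (k + 2)%N) 1 x EG C0); last by clear -kn; lia.
  apply: eq_bigr => m _; rewrite (cbar_k2E wR_integrable) /H'.
  have -> : H D (a - 1) (b - 1) (c - 1) (d - 1) m (k + 2) x y =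
      (R2 (m - (k + 2))%N).[x] * rh ^+ (k + 2) * A (k + 2)%N.
    by apply: H_targetE; rewrite /s0 natrD; ring.
  by rewrite mul1r /C -!subnDA.
- have [eT|eF] := boolP (eta D).
    have [delE del0] := case_ii_sym eT.
    have gE : gam D = - del D by rewrite delE opprK.
    have dc : d = c by rewrite (eq_cd eT).
    have t0 : t = 0 by exact: (t_sym M1E byP oP' oP k gE dc c_gt0).
    have g0 : g = 0.
      have gJ0 : gammaJ D d c k = 0 by exact: (gamma_sym M1E byP oP k gE dc c_gt0).
      by rewrite /g gJ0 mul0r.
    by rewrite t0 g0 oppr0 !mul0r subr0 mul0r addr0 mulr0.
  have {}eF : eta D = false by apply/negbTE.
  (* In case (i) the term with [A k.+1] contains [rho ^+ 2] and [rho * rho'], so a factor [rho] can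
     be taken out and becomes the missing power of [rho] in [H]. *)
  pose p := rpoly D; pose mu := g - t * (c + d + k%:R + 1).
  have rhE : rh = p.[x] by rewrite /rh /rho /rho_of eF.
  have Sp : rho_sq D = p ^+ 2 by rewrite /rho_sq eF.
  have Tp : rho_rho' D = p * p^`() by rewrite /rho_rho' eF.
  have sp : (size p <= (d0 D).+1)%N by exact: leqSpred.
  have sdp : (size p^`() <= d0 D)%N by rewrite (leq_trans (size_deriv_leq _)).
  pose R3 := Rpol D (a - 1, b - 1, s0 + 1).
  pose C i := t * coord R1 (p * (R3 i)^`()) (n - k)%N +
    ((k + 1)%:R * t + g) * coord R1 (p^`() * R3 i) (n - k)%N.
  pose G1 := - t *: (p * V) + mu *: (kappa * p^`() * R1 (n - k)%N).
  have EG : G1 = \sum_(i < (n - k + d0 D).+2) C i *: R3 i.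
    rewrite (_ : C = fun i => t * coord R1 (p * (R3 i)^`()) (n - k)%N +
      ((1 + (s0 + 1)) * t + mu) * coord R1 (p^`() * R3 i) (n - k)%N).
      exact: (expand_k1 L1E byR oR1 (n - k)%N t mu Sp Tp sp L3E oR3).
    apply/funext => i; rewrite /C /mu /s0 natrD.
    by move: (coord _ _ _) (coord _ _ _) => c1 c2; ring.
  have C0 i : (i + (k + 1) < n + 2 - d0 D)%N -> C i = 0.
    move=> ik; rewrite /C.
    rewrite (coord_mul_deriv_low gR1 gR3 sp); last by clear -kn ik; lia.
    rewrite (coord_mul_low gR1 gR3 sdp); last by clear -kn ik; lia.
    by rewrite !mulr0 addr0.
  transitivity (W' * rh ^+ (k + 1) * 1 * A (k + 1)%N * G1.[x]).
    rewrite /G1 /T Tp (hornerD (- t *: (p * V))) !hornerZ (hornerM p V) (hornerM (kappa * p^`())).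
    rewrite (hornerM kappa) (hornerM (p * p^`() * kappa)) (hornerM (p * p^`())).
    rewrite (hornerM p p^`()) exprD -/mu rhE.
    move: (V.[x]) (kappa.[x]) ((R1 (n - k)%N).[x]) (p.[x]) (p^`().[x]) (A (k + 1)%N).
    by move=> Vx kx Rx px dpx Ak; ring.
  rewrite (@weighted_sum_shift C _ R3 _ (k + 1) (n + 2 - d0 D) (n + d0 D + 2).+1
    W' (rh ^+ (k + 1)) (A (k + 1)%N) 1 x EG C0); last by clear -kn; lia.
  apply: eq_bigr => m _; rewrite (cbar_k1E wR_integrable _ _ _ eF) /H'.
  have -> : H D (a - 1) (b - 1) (c - 1) (d - 1) m (k + 1) x y =
      (R3 (m - (k + 1))%N).[x] * rh ^+ (k + 1) * A (k + 1)%N.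
    by apply: H_targetE; rewrite /s0 natrD; ring.
  by rewrite mul1r /C -!subnDA.
Qed.

End Column.
End Expansion.

(** * The differentiation matrix *)

Lemma sum_triangle (R : realType) (F : nat -> nat -> R) N :
  \sum_(m < N) \sum_(j < m.+1) F m j = \sum_(j < N) \sum_(i < N - j) F (i + j)%N j.
Proof.
transitivity (\sum_(m < N) \sum_(j < N | (j <= m)%N) F m j).
  apply: eq_bigr => m _.
  by rewrite (big_ord_widen N (F m)) ?ltn_ord.
rewrite (exchange_big_dep xpredT)//=; apply: eq_bigr => j _.
rewrite (@sum_shift _ (fun i => F (i + j)%N j) _ j 0)// subnK ?(ltnW (ltn_ord j))//.
rewrite big_mkord; apply: eq_bigr => m jm; by rewrite subnK.
Qed.

Lemma sum_range (R : realType) (F : nat -> R) (P : pred nat) lo hi N : (hi <= N)%N ->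
  \sum_(lo <= m < hi | P m) F m =
  \sum_(m < N) (if [&& P m, lo <= m & m < hi]%N then F m else 0).
Proof.
move=> hiN; rewrite (big_nat_widen _ _ N)// (big_nat_widenl _ 0%N)// big_mkord.
by rewrite big_mkcond/=; apply: eq_bigr => m _;
  case: (P m); case: (lo <= m)%N; case: (m < hi)%N.
Qed.

(** For the blocks, whose nonzero entries lie on three diagonals. *)
Lemma sum_three (R : realType) (F : nat -> R) k m :
  (forall j, F j != 0 -> j \in [:: k; k + 1; k + 2]%N) ->
  \sum_(j < m.+1) F j = (if (k <= m)%N then F k else 0) +
    (if (k + 2 <= m)%N then F (k + 2)%N else 0) +
    (if (k + 1 <= m)%N then F (k + 1)%N else 0).
Proof.
move=> F3.
have E j : F j = (if j == k then F j else 0) + (if j == (k + 2)%N then F j else 0) +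
    (if j == (k + 1)%N then F j else 0).
  have [->|/F3] := eqVneq (F j) 0; first by rewrite !if_same !addr0.
  by rewrite !inE => /or3P[] /eqP ->; do !case: eqP; rewrite ?addr0 ?add0r//; lia.
under eq_bigr do rewrite E.
by rewrite !big_split/= -!big_mkcond/= !big_ord1_eq !ltnS.
Qed.

Section Independence.
Context {R : realType} (D : domain R) (a b c d : R).
Hypotheses (a_gt0 : 0 < a) (b_gt0 : 0 < b) (c_gt0 : 0 < c) (d_gt0 : 0 < d).
Hypothesis wR_integrable : (@lebesgue_measure R).-integrable `[alpha D, beta D]
     (EFin \o wR D (a - 1, b - 1, c + d - 1)).

(** With [x] fixed and [z = y / rho x] free, the polynomials [P' l] separate the values of
[l]; then [x] varies, and the polynomials [R] that belong to one [l] are independent. *)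
Lemma H_independent N (e : nat -> nat -> R) :
  (forall x y, inside D x y -> \sum_(m < N) \sum_(j < m.+1)
     H D (a - 1) (b - 1) (c - 1) (d - 1) m j x y * e m j = 0) ->
  forall m j, (m < N)%N -> (j <= m)%N -> e m j = 0.
Proof.
move=> He m j mN jm.
have [M [M1 [_ _ [gP' _ _] _]]] := Pside_functionals D c_gt0 d_gt0.
pose q l := Rpol D (a - 1, b - 1, c - 1 + (d - 1) + 2 * l%:R + 1).
have gq l : graded (q l).
  apply: (Rpol_graded wR_integrable); split=> //=; have := ler0n R l; lra.
pose f l := \sum_(i < N - l) e (i + l)%N l *: q l i.
have f0 x : alpha D < x < beta D -> forall l, (l < N)%N -> (f l).[x] = 0.
  move=> xab; have r0 := rho_inside xab.
  pose g := \sum_(l < N) (rho D x ^+ l * (f l).[x]) *: Ppol D (d - 1) (c - 1) l.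
  have g0 : g = 0.
    apply: (poly_itv_eq0 (lt_gam_del D)) => z /andP[gz zd].
    have ins : inside D x (z * rho D x).
      by split=> //; rewrite !ltr_pM2r// gz.
    rewrite -(He _ _ ins) (sum_triangle (fun m j =>
      H D (a - 1) (b - 1) (c - 1) (d - 1) m j x (z * rho D x) * e m j)) horner_sum; apply: eq_bigr => l _.
    rewrite hornerZ horner_sum mulr_sumr mulr_suml; apply: eq_bigr => i _.
    rewrite /H addnK mulfK ?gt_eqF// hornerZ -/(q l).
    by move: ((q l i).[x]) ((Ppol _ _ _ l).[z]) => X Y; ring.
  move=> l lN; have := graded_free (c := fun l => rho D x ^+ l * (f l).[x]) gP' g0 lN.
  by move=> /eqP; rewrite mulf_eq0 expf_eq0 (gt_eqF r0) andbF => /eqP.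
have fj : f j = 0.
  apply: (poly_itv_eq0 (lt_alpha_beta D)) => x xab; apply: f0 => //.
  exact: leq_ltn_trans mN.
have := graded_free (c := fun i => e (i + j)%N j) (gq j) fj (i := (m - j)%N).
by rewrite subnK//; apply; rewrite ltn_sub2r// (leq_ltn_trans jm).
Qed.

Lemma W_gt0 x y : inside D x y -> 0 < W D (a - 1) (b - 1) (c - 1) (d - 1) x y.
Proof.
move=> [/andP[ax xb] /andP[gy yd]].
by rewrite /W !mulr_gt0// powR_gt0// subr_gt0.
Qed.

(** Both finite expansions of the same derivative are extended to a common range, and the
positive factor [W] is cancelled. *)
Lemma weighted_diff_unique (B B' : block_matrix R) :
  weighted_diff D a b c d B -> weighted_diff D a b c d B' -> B = B'.
Proof.
move=> dB dB'; apply/functional_extensionality_dep => m.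
apply/functional_extensionality_dep => n; apply/matrixP => j k.
have [N1 [B0 dN1]] := dB n k; have [N2 [B'0 dN2]] := dB' n k.
pose N := maxn N1 (maxn N2 m.+1).
have widen (X : block_matrix R) N0 x y : (N0 <= N)%N ->
    (forall m (j : 'I_m.+1), (N0 <= m)%N -> X m n j k = 0) ->
    \sum_(m < N0) \sum_(j < m.+1) W D (a - 1) (b - 1) (c - 1) (d - 1) x y *
      H D (a - 1) (b - 1) (c - 1) (d - 1) m j x y * X m n j k =
    \sum_(m < N) \sum_(j < m.+1) W D (a - 1) (b - 1) (c - 1) (d - 1) x y *
      H D (a - 1) (b - 1) (c - 1) (d - 1) m j x y * X m n j k.
  move=> N0N X0.
  rewrite (big_ord_widen N (fun m => \sum_(j < m.+1) W D (a - 1) (b - 1) (c - 1) (d - 1) x y *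
      H D (a - 1) (b - 1) (c - 1) (d - 1) m j x y * X m n j k) N0N).
  rewrite big_mkcond; apply: eq_bigr => i _; case: ltnP => // N0i.
  by rewrite big1// => l _; rewrite X0// mulr0.
(* Rows indexed by [nat], so that the row index does not depend on the block. *)
pose e m j := B m n (inord j) k - B' m n (inord j) k.
have : e m j = 0.
  apply: (@H_independent N e); last 2 first.
  - by rewrite /N !leq_max leqnn !orbT.
  - by rewrite -ltnS.
  move=> x y ins; have [_ E1] := dN1 x y ins; have [_ E2] := dN2 x y ins.
  have N1N : (N1 <= N)%N by rewrite leq_maxl.
  have N2N : (N2 <= N)%N by rewrite !leq_max leqnn orbT.
  move: E1; rewrite E2 (widen B' N2 _ _ N2N B'0) (widen B N1 _ _ N1N B0).
  move=> /eqP; rewrite -subr_eq0 -opprB oppr_eq0 -sumrB => /eqP E.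
  apply: (mulfI (lt0r_neq0 (W_gt0 ins))); rewrite mulr0 -[RHS]E mulr_sumr.
  apply: eq_bigr => i _; rewrite -sumrB mulr_sumr; apply: eq_bigr => l _.
  by rewrite /e inord_val !mulrBr !mulrA.
by rewrite /e inord_val => /eqP; rewrite subr_eq0 => /eqP.
Qed.

End Independence.

Section Existence.
Context {R : realType} (D : domain R) (a b c d : R).

Definition diff_entry n k m j : R :=
  if (j == k)%N then
    if (n + 1 <= m < (n + deg_rho_sq D + 1).+1)%N then cbar_k D a b c d n k m else 0
  else if (j == k + 2)%N then
    if (n + 3 - deg_rho_sq D <= m < (n + 3).+1)%N then cbar_k2 D a b c d n k m else 0
  else if ~~ eta D && (j == k + 1)%N then
    if (n + 2 - d0 D <= m < (n + d0 D + 2).+1)%N then cbar_k1 D a b c d n k m else 0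
  else 0.

Definition diff_matrix : block_matrix R :=
  fun m n => \matrix_(j, k) diff_entry n k m j.

(** The second and third ranges lie within the bandwidths because of these inequalities. *)
Let deg_d0 : (1 < deg_rho_sq D)%N /\ (eta D = false -> deg_rho_sq D = (d0 D).*2 /\ (1 < d0 D)%N).
Proof.
have := deg_rpoly D; rewrite /deg_rho_sq /rho_sq /d0; case: (eta D) => /= sr.
  by split=> //; move: sr; lia.
have p0 : rpoly D != 0 by apply: contraTneq sr => ->; rewrite size_poly0.
have sp2 : (size (rpoly D ^+ 2)).-1 = ((size (rpoly D)).-1).*2.
  by rewrite size_exp muln2.
rewrite sp2; move: ((size (rpoly D)).-1) sr => s; rewrite addn0 => s2.
by split=> [|_]; [|split=> //]; move: s2; lia.
Qed.

Lemma diff_matrix_block_bandwidths :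
  block_bandwidths diff_matrix ((deg_rho_sq D)%:Z + 1) ((deg_rho_sq D)%:Z - 3).
Proof.
have [dg de] := deg_d0.
move=> m n out; apply/matrixP => j k; rewrite !mxE /diff_entry.
have {out} out : (n + deg_rho_sq D + 1 < m)%N \/ (m + deg_rho_sq D < n + 3)%N.
  by move: out; rewrite /outside_band; lia.
case: eqP => _; first by case: ifP => //; move: out dg; lia.
case: eqP => _; first by case: ifP => //; move: out dg; lia.
case: (eta D) de => //= /(_ erefl)[dd d01]; case: eqP => // _.
by case: ifP => //; move: out dg; lia.
Qed.

Lemma diff_matrix_bandwidths m n : bandwidths (diff_matrix m n) 2 0.
Proof.
move=> j k; rewrite !mxE /diff_entry /outside_band => out.
case: eqP => [jk|_]; first by move: out; rewrite jk; lia.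
case: eqP => [jk|_]; first by move: out; rewrite jk; lia.
by case: (eta D) => //=; case: eqP => // jk; move: out; rewrite jk; lia.
Qed.

Hypotheses (a_gt0 : 0 < a) (b_gt0 : 0 < b) (c_gt0 : 0 < c) (d_gt0 : 0 < d).
Hypothesis eq_cd : eta D -> c = d.
Hypothesis wR_integrable : (@lebesgue_measure R).-integrable `[alpha D, beta D]
     (EFin \o wR D (a - 1, b - 1, c + d - 1)).

Lemma diff_matrixP : weighted_diff D a b c d diff_matrix.
Proof.
move=> n k; pose N := (n + deg_rho_sq D + d0 D + 4)%N.
have kn : (k <= n)%N by rewrite -ltnS.
exists N; split=> [m j Nm|x y ins].
  rewrite mxE /diff_entry; move: Nm; rewrite /N => Nm.
  by do !case: ifP => //; move: Nm; lia.
apply: (is_derive_eq (derive_column a_gt0 b_gt0 c_gt0 d_gt0 eq_cd wR_integrable kn ins)).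
set W' := W D (a - 1) (b - 1) (c - 1) (d - 1) x y.
pose H' m j := H D (a - 1) (b - 1) (c - 1) (d - 1) m j x y.
pose F m j := W' * H' m j * diff_entry n k m j.
have [_ de] := deg_d0.
have Fsupp m j : F m j != 0 -> j \in [:: k : nat; k + 1; k + 2]%N.
  rewrite /F /diff_entry !inE; case: (j == k) => //=; case: (j == k + 1)%N => //=.
  by case: (j == k + 2)%N => //=; rewrite andbF mulr0 eqxx.
rewrite [RHS](eq_bigr (fun m : 'I_N => (if (k <= m)%N then F m k else 0) +
    (if (k + 2 <= m)%N then F m (k + 2)%N else 0) +
    (if (k + 1 <= m)%N then F m (k + 1)%N else 0))); last first.
  move=> m _; rewrite -(sum_three m (Fsupp m)).
  by apply: eq_bigr => j _; rewrite mxE.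
rewrite !big_split/=; congr (_ + _ + _).
- rewrite (@sum_range _ _ xpredT _ _ N); last by clear; lia.
  apply: eq_bigr => m _; rewrite /F /diff_entry eqxx /=.
  case: ifP => [nm|_]; last by rewrite mulr0 if_same.
  have -> : (k <= m)%N by clear -kn nm; lia.
  by rewrite -mulrA mulrC.
- rewrite (@sum_range _ _ (fun m => (k + 2 <= m)%N) _ _ N); last by clear; lia.
  have k2 : (k + 2 == k)%N = false by apply/eqP; clear; lia.
  apply: eq_bigr => m _; rewrite /F /diff_entry k2 eqxx.
  case: (leqP (k + 2)%N m) => //= km.
  case: ifP => _; last by rewrite mulr0.
  by rewrite -mulrA mulrC.
- have k1 : (k + 1 == k)%N = false by apply/eqP; clear; lia.
  have k12 : (k + 1 == k + 2)%N = false by apply/eqP; clear; lia.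
  rewrite /F /diff_entry k1 k12 eqxx andbT; case: (eta D) de => [_|/(_ erefl)[de _]].
    by rewrite big1// => m _; rewrite mulr0 if_same.
  rewrite (@sum_range _ _ (fun m => (k + 1 <= m)%N) _ _ N); last by rewrite /N; clear; lia.
  apply: eq_bigr => m _; case: (leqP (k + 1)%N m) => //= km.
  case: ifP => _; last by rewrite mulr0.
  by rewrite -mulrA mulrC.
Qed.

End Existence.

Theorem proposition5p6 (R : realType) (D : domain R) (a b c d : R)
  (a_gt0 : 0 < a) (b_gt0 : 0 < b) (c_gt0 : 0 < c) (d_gt0 : 0 < d)
  (eq_cd : eta D -> c = d)
  (wR_integrable : (@lebesgue_measure R).-integrable `[alpha D, beta D]
     (EFin \o wR D (a - 1, b - 1, c + d - 1))) :
  (forall (n k : nat), (k <= n)%N -> forall x y : R, inside D x y ->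
     let W' := W D (a - 1) (b - 1) (c - 1) (d - 1) x y in
     let H' m j := H D (a - 1) (b - 1) (c - 1) (d - 1) m j x y in
     is_derive x (1 : R) (fun x' => W D a b c d x' y * H D a b c d n k x' y)
       (\sum_(n + 1 <= m < (n + deg_rho_sq D + 1).+1)
          cbar_k D a b c d n k m * W' * H' m k
        + \sum_(n + 3 - deg_rho_sq D <= m < (n + 3).+1 | (k + 2 <= m)%N)
            cbar_k2 D a b c d n k m * W' * H' m (k + 2)%N
        + (if eta D then 0 else
           \sum_(n + 2 - d0 D <= m < (n + d0 D + 2).+1 | (k + 1 <= m)%N)
             cbar_k1 D a b c d n k m * W' * H' m (k + 1)%N)))
  /\
  (exists Wx : block_matrix R,
     unique (weighted_diff D a b c d) Wx /\
     block_bandwidths Wx ((deg_rho_sq D)%:Z + 1) ((deg_rho_sq D)%:Z - 3) /\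
     (forall m n : nat, bandwidths (Wx m n) 2 0)).
Proof.
split=> [n k kn x y ins W' H'|]; first exact: derive_column.
have dW := diff_matrixP a_gt0 b_gt0 c_gt0 d_gt0 eq_cd wR_integrable.
exists (diff_matrix D a b c d); split; last first.
  by split; [exact: diff_matrix_block_bandwidths|exact: diff_matrix_bandwidths].
by split=> // B dB; apply: (weighted_diff_unique c_gt0 d_gt0 wR_integrable).
Qed.
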